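(* Let $\alpha>1$, and for each $d\ge1$ let $\boldsymbol{\gamma}_d=(\gamma_{d,1},\ldots,\gamma_{d,d})$ satisfy $1\ge\gamma_{d,1}\ge\ldots\ge\gamma_{d,d}>0$. Assume that $$s_{\boldsymbol{\gamma}}:=\inf\Big\{s\ge0\colon\sup_{d\ge1}\sum_{j=1}^d\gamma_{d,j}^s<\infty\Big\}<1,$$ and put $\tilde\alpha=\min\{\alpha,1/s_{\boldsymbol{\gamma}}\}$ (with $1/0=\infty$). Then for each $t\in(0,\frac{\tilde\alpha-1}{2})$ there is a constant $c_{\alpha,\tilde\alpha,t}$ that does not depend on the dimension $d$ (nor on $N$ and $\Lambda$) such that for every $d\ge1$, every $N\ge1$, and every multiple rank-1 lattice $\Lambda=\Lambda(\boldsymbol{z}_1,M_1,\ldots,\boldsymbol{z}_L,M_L)$ for which, with $I=A_d(N)$, $I=\bigcup_{\ell=1}^LI_\ell$, $L\le\max(3\ln|A_d(N)|,1)$, $M_1=\ldots=M_L\le3|A_d(N)|$, and $M:=|\Lambda|$ satisfies $2|A_d(N)|<M<9|A_d(N)|\max(\ln|A_d(N)|,1)$, one has $$\sup_{\|f|\mathcal{H}_{\alpha,\boldsymbol{\gamma}_d}(\mathbb{T}^d)\|\le1}\|f-\operatorname{S}_{A_d(N)}^\Lambda f\,|\,L_\infty(\mathbb{T}^d)\|<c_{\alpha,\tilde\alpha,t}\,M^{-t},$$ i.e. strong tractability (a bound of order $M^{-t}$ with constant independent of $d$) holds for each such $t$.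
   Context: $\mathbb{T}\sim[0,1)$, and $c_{\boldsymbol{h}}(f)=\int_{\mathbb{T}^d}f(\boldsymbol{x})\mathrm{e}^{-2\pi\mathrm{i}\boldsymbol{h}\cdot\boldsymbol{x}}\,\mathrm{d}\boldsymbol{x}$. The weight function is $r_d(\alpha,\boldsymbol{\gamma}_d,\boldsymbol{h})=\prod_{j=1}^d\max(1,\gamma_{d,j}^{-1}|h_j|^\alpha)$ for $\boldsymbol{h}\in\mathbb{Z}^d$. The weighted Korobov space $\mathcal{H}_{\alpha,\boldsymbol{\gamma}_d}(\mathbb{T}^d)$ consists of all $f\in L_1(\mathbb{T}^d)$ with $\|f|\mathcal{H}_{\alpha,\boldsymbol{\gamma}_d}(\mathbb{T}^d)\|=\left(\sum_{\boldsymbol{h}\in\mathbb{Z}^d}r_d(\alpha,\boldsymbol{\gamma}_d,\boldsymbol{h})|c_{\boldsymbol{h}}(f)|^2\right)^{1/2}<\infty$; functions are identified with their continuous representatives, and point values refer to these. The frequency sets are $A_d(N)=\{\boldsymbol{h}\in\mathbb{Z}^d\colon r_d(\alpha,\boldsymbol{\gamma}_d,\boldsymbol{h})\le N\}$. The constant may depend on $\alpha,\tilde\alpha,t$ and on the whole family of weights $(\boldsymbol{\gamma}_d)_{d\ge1}$. For $\boldsymbol{z}\in\mathbb{Z}^d$, $M'\in\mathbb{N}$, the rank-1 lattice is $\Lambda(\boldsymbol{z},M')=\{\frac{j}{M'}\boldsymbol{z}\bmod\boldsymbol{1}\colon j=0,\ldots,M'-1\}\subset\mathbb{T}^d$; a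 multiple rank-1 lattice is $\Lambda(\boldsymbol{z}_1,M_1,\ldots,\boldsymbol{z}_L,M_L)=\bigcup_{\ell=1}^L\Lambda(\boldsymbol{z}_\ell,M_\ell)$ with $L\in\mathbb{N}$, $\boldsymbol{z}_\ell\in\mathbb{Z}^d$, $M_\ell\in\mathbb{N}$. Given a finite $I\subset\mathbb{Z}^d$ and these parameters, define recursively the pairwise disjoint sets $$I_\ell=\Big\{\boldsymbol{h}\in I\setminus\bigcup_{j=1}^{\ell-1}I_j\colon \boldsymbol{h}\cdot\boldsymbol{z}_\ell\not\equiv\boldsymbol{k}\cdot\boldsymbol{z}_\ell\ (\mathrm{mod}\ M_\ell)\text{ for all }\boldsymbol{k}\in I\setminus\{\boldsymbol{h}\}\Big\},\quad\ell=1,\ldots,L,$$ and $$\operatorname{S}_I^\Lambda f(\boldsymbol{x})=\sum_{\ell=1}^L\sum_{\boldsymbol{h}\in I_\ell}\hat f_{\boldsymbol{h}}\,\mathrm{e}^{2\pi\mathrm{i}\boldsymbol{h}\cdot\boldsymbol{x}},\qquad \hat f_{\boldsymbol{h}}=\frac{1}{M_\ell}\sum_{j=0}^{M_\ell-1}f\Big(\frac{j\boldsymbol{z}_\ell}{M_\ell}\Big)\mathrm{e}^{-2\pi\mathrm{i}j\,\boldsymbol{h}\cdot\boldsymbol{z}_\ell/M_\ell}\quad\text{for }\boldsymbol{h}\in I_\ell.$$ *)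

(* Defs.v *)
From HB Require Import structures.
From mathcomp Require Import all_boot all_order all_algebra finmap complex.
From mathcomp Require Import all_classical all_reals all_analysis.

Set Implicit Arguments.
Unset Strict Implicit.
Unset Printing Implicit Defensive.

Import Order.TTheory GRing.Theory Num.Theory.
Import numFieldNormedType.Exports.

Local Open Scope classical_set_scope.
Local Open Scope ring_scope.

(* The library puts a product sigma-algebra on tuples but not on row vectors;
   row vectors are used here because they carry the topology and the module
   structure. *)
Definition measure_row_display : measure_display -> measure_display.
Proof. exact. Qed.

Section measurable_row.
Context {disp} {T : sigmaRingType disp} (n : nat).

Let coors : 'I_n -> 'rV[T]_n -> T := fun i x => x ord0 i.

Let row_set0 : g_sigma_preimage coors set0.
Proof. exact: sigma_algebra0. Qed.

Let row_setC A : g_sigma_preimage coors A -> g_sigma_preimage coors (~` A).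
Proof. exact: sigma_algebraC. Qed.

Let row_bigcup (F : _^nat) : (forall i, g_sigma_preimage coors (F i)) ->
  g_sigma_preimage coors (\bigcup_i (F i)).
Proof. exact: sigma_algebra_bigcup. Qed.

HB.instance Definition _ := @isMeasurable.Build (measure_row_display disp)
  'rV[T]_n (g_sigma_preimage coors) row_set0 row_setC row_bigcup.

End measurable_row.

Section measurable_row_lemmas.
Context {d1 d2} {T1 : measurableType d1} {T2 : measurableType d2}.

Lemma measurable_coord n (i : 'I_n) :
  measurable_fun [set: 'rV[T2]_n] (fun x : 'rV[T2]_n => x ord0 i).
Proof.
move=> _ Y mY; rewrite setTI; apply: sub_sigma_algebra => /=.
rewrite -bigcup_seq/=; exists i => /=; first by rewrite mem_index_enum.
by exists Y => //; rewrite setTI.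
Qed.

Lemma measurable_fun_row n (f : T1 -> 'rV[T2]_n) :
  (forall i, measurable_fun [set: T1] (fun x => f x ord0 i)) ->
  measurable_fun [set: T1] f.
Proof.
move=> mf _ A mA; rewrite setTI.
suff : measurable `<=` [set B : set 'rV[T2]_n | measurable (f @^-1` B)] by exact.
apply: smallest_sub.
  split=> /=; first by rewrite preimage_set0.
    by move=> B mB; rewrite setTD preimage_setC; exact: measurableC.
  by move=> F mF; rewrite preimage_bigcup; exact: bigcup_measurable.
rewrite -bigcup_seq => B [i _ [Y mY <-]] /=.
by have := mf i measurableT Y mY; rewrite !setTI.
Qed.

End measurable_row_lemmas.

Section cell_measure.
Context {R : realType}.
Notation mR := (measurableTypeR R).

Let mI : measurable (`[0, 1[ : set mR). Proof. exact: measurable_itv. Qed.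

Definition unit_lebesgue : set mR -> \bar R := mrestr lebesgue_measure mI.

HB.instance Definition _ := Measure.on unit_lebesgue.

Let unit_lebesgueT : unit_lebesgue [set: mR] = 1%E.
Proof.
by rewrite /unit_lebesgue /mrestr setTI lebesgue_measure_itv/= lte01 oppr0 adde0.
Qed.

HB.instance Definition _ :=
  Measure_isProbability.Build _ _ _ unit_lebesgue unit_lebesgueT.

Definition row_cons n (p : mR * 'rV[mR]_n) : 'rV[mR]_n.+1 :=
  \row_i (if unlift ord0 i is Some j then p.2 ord0 j else p.1).

Let measurable_row_cons n : measurable_fun [set: mR * 'rV[mR]_n] (@row_cons n).
Proof.
apply: measurable_fun_row => i; rewrite /row_cons.
case: (unliftP ord0 i) => [j ->|->].
  rewrite (_ : (fun _ => _) = (fun x : 'rV[mR]_n => x ord0 j) \o snd).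
    by apply: measurableT_comp => //; exact: measurable_coord.
  by apply/funext => p /=; rewrite mxE liftK.
rewrite (_ : (fun _ => _) = fst); first exact: measurable_fst.
by apply/funext => p /=; rewrite mxE unlift_none.
Qed.

HB.instance Definition _ n :=
  isMeasurableFun.Build _ _ _ _ (@row_cons n) (@measurable_row_cons n).

(* The d-fold product measure: see cell_measure_box. *)
Fixpoint cell_measure (d : nat) : probability 'rV[mR]_d R :=
  if d is d'.+1 return probability 'rV[mR]_d R then
    distribution (unit_lebesgue \x cell_measure d')%E (@row_cons d')
  else @dirac _ 'rV[mR]_0 (0 : 'rV[R]_0) R.

Lemma cell_measure_box d (A : 'I_d -> set mR) : (forall i, measurable (A i)) ->
  cell_measure d [set x : 'rV[mR]_d | forall i, A i (x ord0 i)] =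
  (\prod_(i < d) unit_lebesgue (A i))%E.
Proof.
elim: d A => [|d IHd] A mA.
  by rewrite big_ord0 /= diracE mem_set// => -[].
rewrite big_ord_recl -IHd//= /distribution /pushforward.
rewrite -product_measure1E//; last first.
  have -> : [set x : 'rV[mR]_d | forall i, A (lift ord0 i) (x ord0 i)] =
      \bigcap_(i in [set: 'I_d])
        ((fun x : 'rV[mR]_d => x ord0 i) @^-1` A (lift ord0 i)).
    by apply/seteqP; split=> [x Ax i _|x Ax i]; exact: Ax.
  apply: fin_bigcap_measurable => // i _; rewrite -[X in measurable X]setTI.
  exact: measurable_coord.
congr product_measure1; apply/seteqP; split=> -[u v] /=.
  move=> Auv; split; first by have := Auv ord0; rewrite mxE unlift_none.
  by move=> i; have := Auv (lift ord0 i); rewrite mxE liftK.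
move=> [Au Av] i; rewrite mxE.
by case: (unliftP ord0 i) => [j ->|->].
Qed.

End cell_measure.

Section korobov.
Context {R : realType} {d : nat}.
Local Notation Re := (@complex.Re R).
Local Notation Im := (@complex.Im R).
Implicit Types (h k z : 'rV[int]_d) (x : 'rV[R]_d) (f g : 'rV[R]_d -> R[i]).

Definition int_row h : 'rV[R]_d := map_mx intr h.

Definition dotz h k : int := \sum_i h ord0 i * k ord0 i.

Definition dotr h x : R := \sum_i (h ord0 i)%:~R * x ord0 i.

Definition expi2pi (u : R) : R[i] :=
  Complex (cos (2 * pi * u)) (sin (2 * pi * u)).

(* Functions on T^d are represented by 1-periodic functions on R^d. *)
Definition torus_fun f := forall x k, f (x + int_row k) = f x.

Definition torus_L1 f :=
  (cell_measure d).-integrable setT (EFin \o Re \o f) /\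
  (cell_measure d).-integrable setT (EFin \o Im \o f).

Definition fourier_coef f h : R[i] :=
  let F x := f x * expi2pi (- dotr h x) in
  Complex (\int[cell_measure d]_x Re (F x))
          (\int[cell_measure d]_x Im (F x)).

Definition Linfty_norm f : \bar R :=
  ('N[cell_measure d]_+oo [(fun x => (Normc.normc (f x))%:E)])%E.

Definition korobov_weight (alpha : R) (gamma : 'I_d -> R) h : R :=
  \prod_(j < d) Num.max 1 ((gamma j)^-1 * (`|h ord0 j|%:~R `^ alpha)).

Definition korobov_norm (alpha : R) (gamma : 'I_d -> R) f : \bar R :=
  ((\esum_(h in [set: 'rV[int]_d])
      (korobov_weight alpha gamma h * Normc.normc (fourier_coef f h) ^+ 2)%:E)
   `^ 2^-1)%E.

Definition korobov_space (alpha : R) (gamma : 'I_d -> R) :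
    set ('rV[R]_d -> R[i]) :=
  [set f | [/\ torus_fun f, torus_L1 f & (korobov_norm alpha gamma f < +oo)%E]].

Definition continuous_representative f g :=
  [/\ torus_fun g,
      continuous (Re \o g) /\ continuous (Im \o g)
    & {ae cell_measure d, forall x, f x = g x}].

Definition frequency_set (alpha : R) (gamma : 'I_d -> R) (N : R) :
    set 'rV[int]_d :=
  [set h | korobov_weight alpha gamma h <= N].

End korobov.

(* Junk value 0 on infinite sets. *)
Definition card_of {T : choiceType} (A : set T) : nat := #|` fset_set A|.

Section lattice.
Context {R : realType} {d L : nat}.
Variables (z : 'I_L -> 'rV[int]_d) (M : 'I_L -> nat).

Definition frac_row (x : 'rV[R]_d) : 'rV[R]_d :=
  map_mx (fun u : R => u - (Num.floor u)%:~R) x.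

Definition lattice_node (l : 'I_L) (j : nat) : 'rV[R]_d :=
  (j%:R / (M l)%:R) *: int_row (z l).

Definition rank1_lattice (l : 'I_L) : set 'rV[R]_d :=
  [set frac_row (lattice_node l j) | j in [set j | (j < M l)%N]].

Definition multiple_lattice : set 'rV[R]_d :=
  \bigcup_(l in [set: 'I_L]) rank1_lattice l.

Definition alias_free (I : set 'rV[int]_d) (l : 'I_L) (h : 'rV[int]_d) :=
  forall k, I k -> k != h -> (dotz h (z l) != dotz k (z l) %[mod M l])%Z.

(* The union of the alias_free_part I l over the indices l < n: see coveredE. *)
Fixpoint covered (I : set 'rV[int]_d) (n : nat) : set 'rV[int]_d :=
  if n is n'.+1 then
    covered I n' `|`
    [set h | (I `\` covered I n') h /\
             exists2 l : 'I_L, l = n' :> nat & alias_free I l h]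
  else set0.

Definition alias_free_part (I : set 'rV[int]_d) (l : 'I_L) : set 'rV[int]_d :=
  [set h | (I `\` covered I l) h /\ alias_free I l h].

Lemma coveredE I n :
  covered I n = \bigcup_(l in [set l : 'I_L | (l < n)%N]) alias_free_part I l.
Proof.
elim: n => [|n IHn] /=; first by apply/seteqP; split=> // h [].
apply/seteqP; split=> [h [|[Ih [l ln al]]]|h [l /= ln hl]].
- by rewrite IHn => -[l /= ln hl]; exists l => //=; exact: ltnW.
- by exists l; rewrite /= ?ln//; split=> //; rewrite ln.
- move: ln; rewrite ltnS leq_eqVlt => /predU1P[ln|ln].
    by right; case: hl; rewrite ln => Ih al; split=> //; exists l.
  by left; rewrite IHn; exists l.
Qed.

Definition lattice_coef (f : 'rV[R]_d -> R[i]) (l : 'I_L) (h : 'rV[int]_d) :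
    R[i] :=
  (M l)%:R^-1 * \sum_(j < M l)
    f (lattice_node l j) *
    expi2pi (- (j%:R * (dotz h (z l))%:~R / (M l)%:R)).

Definition lattice_approx (I : set 'rV[int]_d) (f : 'rV[R]_d -> R[i])
    (x : 'rV[R]_d) : R[i] :=
  \sum_(l < L) \sum_(h \in alias_free_part I l)
    lattice_coef f l h * expi2pi (dotr h x).

End lattice.

Section tractability.
Context {R : realType}.

(* Point values are taken from the continuous representative g of f. *)
Definition worst_case_error (d L : nat) (alpha : R) (gamma : 'I_d -> R)
    (I : set 'rV[int]_d) (z : 'I_L -> 'rV[int]_d) (M : 'I_L -> nat) : \bar R :=
  ereal_sup [set e | exists f g,
    [/\ korobov_space alpha gamma f, (korobov_norm alpha gamma f <= 1)%E,
        continuous_representative f g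
      & e = Linfty_norm (fun x => g x - lattice_approx z M I g x)]].

Definition weight_decay (gamma : forall d, 'I_d -> R) : \bar R :=
  ereal_inf [set s%:E | s in [set s : R | 0 <= s /\
    (ereal_sup [set (\sum_(j < d) gamma d j `^ s)%:E |
                d in [set d | (1 <= d)%N]] < +oo)%E]].

Definition alpha_tilde (alpha : R) (gamma : forall d, 'I_d -> R) : \bar R :=
  Order.min alpha%:E (weight_decay gamma)^-1%E.

End tractability.

(* Main.v *)
Require Import Defs.
From mathcomp Require Import all_boot all_order all_algebra finmap complex.
From mathcomp Require Import all_classical all_reals all_analysis.
From mathcomp Require Import measurable_realfun ess_sup_inf ring lra.
Set Implicit Arguments.
Unset Strict Implicit.
Unset Printing Implicit Defensive.

Import Order.TTheory GRing.Theory Num.Theory.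
Import numFieldNormedType.Exports.
Local Open Scope classical_set_scope.
Local Open Scope ring_scope.

(** Write [c_h] for the Fourier coefficients of [f], [e_h] for the characters,
    [r] for the weight, [I] for the set of frequencies with [r h <= N], [S] for
    the approximation operator, and [n] for the cardinal of [I].

    Aliasing.  The rule maps [e_k] to the sum, over the lattices [l], of the
    [e_h] with [h] in the part [I_l] and [h] congruent to [k] along [z_l].
    Freeness of aliases leaves at most one such [h] for every [l].  Hence
    [S e_k = e_k] for [k] in [I], and [|S e_k| <= L] for every other [k]
    ([lattice_approx_exact], [normc_lattice_approx_character]).  Therefore, on
    trigonometric polynomials, the error is at most [1 + L] times the sum of the
    moduli of the coefficients with frequency outside [I].

    From polynomials to [f].  The passage goes through the Fejer means
    [s_m = m^-d * \sum_(a, b) c_(a - b) e_(a - b)], with [a] and [b] in the box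
    [0, m)^d, rather than through the Fourier series, because their pointwise
    convergence is elementary in any number of variables.  For a fixed
    [a] the frequencies [a - b] are distinct, so the error for [s_m] is at most
    [1 + L] times any bound on the finite sums of [|c_h|] over frequencies outside
    [I] ([fejer_mean_lattice_error]).  Moreover [s_m] converges pointwise to the
    continuous representative ([fejer_mean_cvg]), and [S] only sees finitely
    many point values, so the bound passes to the limit
    ([lattice_error_cvg]).  The convergence is obtained as in Korovkin's theorem:
    the Fejer kernel is nonnegative, of integral 1, and the integral of
    [1 - cos] against it is at most [1 / m] in every coordinate direction.

    Independence of the dimension.  The hypothesis on [t] allows one to choose
    an exponent [q] with [1 / alpha < q < 1 / (2 t + 1)] for which the sums of
    [gamma_j `^ q] are bounded in [d] ([exponent_exists]).  As the weight is a
    product, [\sum_h r h `^ (- q)] is at most a product of factors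
    [1 + 2 Z gamma_j `^ q], which is bounded by a constant [C] independent of [d]
    ([sum_weight_le_expR]).  Rankin's trick then gives both [n <= C N `^ q] and
    [\sum_(r h > N) 1 / r h <= C N `^ (q - 1)], and by Cauchy-Schwarz the sum of
    the [|c_h|] with [h] outside [I] is at most the square root of the latter,
    that is, of order [n `^ (- (1 / q - 1) / 2)].  Since [t < (1 / q - 1) / 2], the
    remaining power of [n] absorbs the factor [1 + L] and the logarithm in the
    size of the lattice ([rate_bound]). *)

(** * Roots of unity and complex moduli *)

Section exponential.
Context {R : realType}.
Implicit Types (u v : R).
Local Notation normc := Normc.normc.

Lemma expi2pi0 : expi2pi (0 : R) = 1.
Proof. by rewrite /expi2pi mulr0 cos0 sin0. Qed.

Lemma expi2piD u v : expi2pi (u + v) = expi2pi u * expi2pi v.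
Proof.
rewrite /expi2pi mulrDr cosD sinD; apply/eqP; rewrite eq_complex /=.
by apply/andP; split; apply/eqP; ring.
Qed.

Lemma normc_expi2pi u : normc (expi2pi u) = 1.
Proof. by rewrite /expi2pi /= cos2Dsin2 sqrtr1. Qed.

Lemma expi2pi_nat (n : nat) u : expi2pi (n%:R * u) = expi2pi u ^+ n.
Proof.
elim: n => [|n IHn]; first by rewrite mul0r expi2pi0 expr0.
by rewrite -natr1 mulrDl mul1r expi2piD IHn exprSr.
Qed.

Lemma expi2piN u : expi2pi (- u) = (expi2pi u)^-1.
Proof.
have e0 : expi2pi u != 0.
  apply/eqP => /(congr1 (@Normc.normc R)); rewrite normc_expi2pi Normc.normc0 => /eqP.
  by rewrite oner_eq0.
by apply: (mulfI e0); rewrite -expi2piD subrr expi2pi0 mulfV.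
Qed.

Lemma expi2pi_int (m : int) : expi2pi (m%:~R : R) = 1.
Proof.
suff H (n : nat) : expi2pi (n%:R : R) = 1.
  by case: m => n; rewrite ?NegzE ?rmorphN/= ?expi2piN H// invr1.
rewrite -[n%:R]mulr1 expi2pi_nat.
by rewrite /expi2pi mulr1 mulr_natl cos2pi sin2pi expr1n.
Qed.

Lemma expi2pi_neq1 u : 0 < u < 1 -> expi2pi u != 1.
Proof.
move=> /andP[u0 u1]; apply/eqP => /(congr1 (@complex.Re R)) /=.
have -> : 2 * pi * u = (pi * u) *+ 2 by rewrite mulr2n; ring.
rewrite cos_mulr2n cos2sin2 => H.
have : 0 < sin (pi * u) ^+ 2.
  rewrite exprn_gt0// sin_gt0_pi// mulr_gt0 ?pi_gt0//=.
  by rewrite -[ltRHS]mulr1 ltr_pM2l ?pi_gt0.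
by rewrite mulr2n in H; lra.
Qed.

(** The powers of a nontrivial root of unity sum up to zero; this is what makes
    the rule see a character only through a congruence. *)
Lemma sum_expi2pi (m : nat) (a : int) : (0 < m)%N ->
  \sum_(j < m) expi2pi (j%:R * (a%:~R / m%:R) : R) = (m * (m %| a)%Z)%:R.
Proof.
move=> m0; have mR0 : (m%:R : R) != 0 by rewrite pnatr_eq0 -lt0n.
pose w : R[i] := expi2pi (a%:~R / m%:R : R).
have -> : \sum_(j < m) expi2pi (j%:R * (a%:~R / m%:R) : R) = \sum_(j < m) w ^+ j.
  by apply: eq_bigr => j _; rewrite expi2pi_nat.
have aE := divz_eq a m.
have wE : w = expi2pi ((a %% m)%Z%:~R / m%:R : R).
  rewrite /w {1}aE rmorphD rmorphM /= mulrDl -mulrA mulfV// mulr1.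
  by rewrite expi2piD expi2pi_int mul1r.
have m0' : (m : int) != 0 by rewrite eqz_nat -lt0n.
have [dv|ndv] := boolP (m %| a)%Z.
  rewrite muln1 wE; move/dvdz_mod0P: dv => ->.
  rewrite mul0r expi2pi0; under eq_bigr do rewrite expr1n.
  by rewrite sumr_const card_ord.
rewrite muln0 /=; have w1 : w != 1.
  rewrite wE; apply: expi2pi_neq1; rewrite divr_gt0 ?ltr0n//=; last first.
    rewrite ltr0z lt_neqAle modz_ge0// andbT eq_sym.
    by apply: contra ndv => /eqP/dvdz_mod0P.
  by rewrite ltr_pdivrMr ?ltr0n// mul1r [ltRHS]pmulrn ltr_int ltz_pmod// ltz_nat.
apply: (@mulfI _ (w - 1)); first by rewrite subr_eq0.
by rewrite -subrX1 -expi2pi_nat mulrC divfK// expi2pi_int subrr mulr0.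
Qed.

Lemma normc_sum (J : Type) (s : seq J) (F : J -> R[i]) :
  normc (\sum_(i <- s) F i) <= \sum_(i <- s) normc (F i).
Proof.
elim: s => [|i s IHs]; first by rewrite !big_nil Normc.normc0.
by rewrite !big_cons (le_trans (le_normcD _ _))// lerD2l.
Qed.

Lemma normc_nat (n : nat) : normc (n%:R : R[i]) = n%:R.
Proof. by rewrite normcMn Normc.normc1. Qed.

End exponential.

(** * Complex-valued integrals and characters of the torus *)

Section complex_integral.
Context {d} {T : measurableType d} {R : realType} (mu : {measure set T -> \bar R}).
Implicit Types (F G : T -> R[i]) (c : R[i]).
Local Notation Re := (@complex.Re R).
Local Notation Im := (@complex.Im R).
Local Notation integrableR f := (mu.-integrable setT (EFin \o f)).

Lemma integrableR_add (f g : T -> R) :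
  integrableR f -> integrableR g -> integrableR (fun x => f x + g x).
Proof. by move=> intf intg; exact: (integrableD measurableT intf intg). Qed.

Lemma integrableR_sub (f g : T -> R) :
  integrableR f -> integrableR g -> integrableR (fun x => f x - g x).
Proof. by move=> intf intg; exact: (integrableB measurableT intf intg). Qed.

Lemma integrableR_scale (k : R) (f : T -> R) :
  integrableR f -> integrableR (fun x => k * f x).
Proof. by move=> intf; exact: (integrableZl measurableT k intf). Qed.

Definition cintegrable F := integrableR (Re \o F) /\ integrableR (Im \o F).

Definition cintegral F : R[i] :=
  Complex (\int[mu]_x Re (F x)) (\int[mu]_x Im (F x)).

Lemma cintegrable0 : cintegrable (fun=> 0).
Proof. by split; exact: integrable0. Qed.

Lemma cintegral0 : cintegral (fun=> 0) = 0.
Proof. by rewrite /cintegral /= /Rintegral integral0. Qed.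

Lemma cintegrableD F G :
  cintegrable F -> cintegrable G -> cintegrable (fun x => F x + G x).
Proof.
move=> [F1 F2] [G1 G2]; split.
  by rewrite (_ : Re \o _ = fun x => Re (F x) + Re (G x)); [exact: integrableR_add|
    apply/funext => x /=; rewrite raddfD].
by rewrite (_ : Im \o _ = fun x => Im (F x) + Im (G x)); [exact: integrableR_add|
  apply/funext => x /=; rewrite raddfD].
Qed.

Lemma cintegralD F G : cintegrable F -> cintegrable G ->
  cintegral (fun x => F x + G x) = cintegral F + cintegral G.
Proof.
move=> [F1 F2] [G1 G2]; rewrite /cintegral.
rewrite (_ : (fun x => Re (F x + G x)) = fun x => Re (F x) + Re (G x)); last first.
  by apply/funext => x /=; rewrite raddfD.
rewrite (_ : (fun x => Im (F x + G x)) = fun x => Im (F x) + Im (G x)); last first.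
  by apply/funext => x /=; rewrite raddfD.
by rewrite (RintegralD measurableT F1 G1) (RintegralD measurableT F2 G2).
Qed.

Lemma cintegrableZ c F : cintegrable F -> cintegrable (fun x => c * F x).
Proof.
move=> [F1 F2]; case: c => a b; split.
  rewrite (_ : Re \o _ = fun x => a * Re (F x) - b * Im (F x)).
    by apply: integrableR_sub; exact: integrableR_scale.
  by apply/funext => x /=; case: (F x).
rewrite (_ : Im \o _ = fun x => a * Im (F x) + b * Re (F x)).
  by apply: integrableR_add; exact: integrableR_scale.
by apply/funext => x /=; case: (F x).
Qed.

Lemma cintegralZ c F : cintegrable F ->
  cintegral (fun x => c * F x) = c * cintegral F.
Proof.
move=> [F1 F2]; case: c => a b; rewrite /cintegral.
rewrite (_ : (fun x => Re (_ * F x)) = fun x => a * Re (F x) - b * Im (F x)).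
  rewrite (_ : (fun x => Im (_ * F x)) = fun x => a * Im (F x) + b * Re (F x)).
    rewrite RintegralB//; [|exact: integrableR_scale..].
    rewrite RintegralD//; [|exact: integrableR_scale..].
    by rewrite !RintegralZl.
  by apply/funext => x /=; case: (F x).
by apply/funext => x /=; case: (F x).
Qed.

Lemma cintegrable_sum (I : Type) (s : seq I) (F : I -> T -> R[i]) :
  (forall i, cintegrable (F i)) -> cintegrable (fun x => \sum_(i <- s) F i x).
Proof.
move=> iF; elim: s => [|i s IHs].
  by under eq_fun do rewrite big_nil; exact: cintegrable0.
by under eq_fun do rewrite big_cons; exact: cintegrableD.
Qed.

Lemma cintegral_sum (I : Type) (s : seq I) (F : I -> T -> R[i]) :
  (forall i, cintegrable (F i)) ->
  cintegral (fun x => \sum_(i <- s) F i x) = \sum_(i <- s) cintegral (F i).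
Proof.
move=> iF; elim: s => [|i s IHs].
  by under eq_fun do rewrite big_nil; rewrite cintegral0 big_nil.
under eq_fun do rewrite big_cons.
rewrite cintegralD ?big_cons ?IHs//; exact: cintegrable_sum.
Qed.

Lemma cintegrableM_bounded F G (B : R) : cintegrable F ->
  measurable_fun setT (Re \o G) -> measurable_fun setT (Im \o G) ->
  (forall x, Normc.normc (G x) <= B) -> cintegrable (fun x => F x * G x).
Proof.
move=> [F1 F2] mG1 mG2 GB.
have leR x : `|Re (G x)| <= B.
  apply: le_trans (GB x); case: (G x) => a b /=.
  by rewrite -sqrtr_sqr ler_wsqrtr// lerDl sqr_ge0.
have leI x : `|Im (G x)| <= B.
  apply: le_trans (GB x); case: (G x) => a b /=.
  by rewrite -sqrtr_sqr ler_wsqrtr// lerDr sqr_ge0.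
have bnd (h : T -> R) : (forall x, `|h x| <= B) -> [bounded h x | x in setT].
  move=> hB; exists B; split; first exact: num_real.
  by move=> y By x _ /=; apply: le_trans (hB x) (ltW By).
have intM (f h : T -> R) : integrableR f -> measurable_fun setT h ->
    (forall x, `|h x| <= B) -> integrableR (fun x => f x * h x).
  by move=> intf mh hB; exact: (integrableMl measurableT intf mh (bnd _ hB)).
split.
  rewrite (_ : Re \o _ = fun x => Re (F x) * Re (G x) - Im (F x) * Im (G x)).
    by apply: integrableR_sub; exact: intM.
  by apply/funext => x /=; case: (F x) => a b; case: (G x).
rewrite (_ : Im \o _ = fun x => Re (F x) * Im (G x) + Im (F x) * Re (G x)).
  by apply: integrableR_add; exact: intM.
by apply/funext => x /=; case: (F x) => a b; case: (G x).
Qed.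

End complex_integral.

Section torus_characters.
Context {R : realType}.
Local Notation Re := (@complex.Re R).
Local Notation Im := (@complex.Im R).
Local Notation mR := (measurableTypeR R).

Definition character n (h : 'rV[int]_n) (x : 'rV[R]_n) : R[i] :=
  expi2pi (dotr h x).

Section dim.
Context {n : nat}.
Implicit Types (h k : 'rV[int]_n) (x y : 'rV[R]_n).

Lemma dotr_addl h k x : dotr (h + k) x = dotr h x + dotr k x.
Proof.
by rewrite -big_split; apply: eq_bigr => i _; rewrite mxE rmorphD mulrDl.
Qed.

Lemma dotr_oppl h x : dotr (- h) x = - dotr h x.
Proof.
by rewrite -sumrN; apply: eq_bigr => i _; rewrite mxE rmorphN mulNr.
Qed.

Lemma dotr_addr h x y : dotr h (x + y) = dotr h x + dotr h y.
Proof. by rewrite -big_split; apply: eq_bigr => i _; rewrite mxE mulrDr. Qed.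

Lemma dotr_oppr h x : dotr h (- x) = - dotr h x.
Proof. by rewrite -sumrN; apply: eq_bigr => i _; rewrite mxE mulrN. Qed.

Lemma measurable_cosR : measurable_fun [set: R] (@cos R).
Proof. exact: (continuous_measurable_fun (@continuous_cos R)). Qed.

Lemma measurable_sinR : measurable_fun [set: R] (@sin R).
Proof. exact: (continuous_measurable_fun (@continuous_sin R)). Qed.

Lemma measurable_dotr h : measurable_fun [set: 'rV[mR]_n] (dotr h : 'rV[mR]_n -> R).
Proof.
apply: measurable_sum => i; apply: measurable_funM => //.
exact: (@measurable_coord _ mR).
Qed.

Lemma measurable_Re_character h :
  measurable_fun [set: 'rV[mR]_n] (Re \o character h : 'rV[mR]_n -> R).
Proof.
apply: (measurableT_comp measurable_cosR).
by apply: measurable_funM => //; exact: measurable_dotr.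
Qed.

Lemma measurable_Im_character h :
  measurable_fun [set: 'rV[mR]_n] (Im \o character h : 'rV[mR]_n -> R).
Proof.
apply: (measurableT_comp measurable_sinR).
by apply: measurable_funM => //; exact: measurable_dotr.
Qed.

Lemma cintegrableM_character (F : 'rV[mR]_n -> R[i]) h :
  cintegrable (cell_measure n) F ->
  cintegrable (cell_measure n) (fun x => F x * character h x).
Proof.
move=> intF; apply: (cintegrableM_bounded (B := 1)) => //.
- exact: measurable_Re_character.
- exact: measurable_Im_character.
- by move=> x; rewrite normc_expi2pi.
Qed.

Lemma cintegrable_character h : cintegrable (cell_measure n) (character h).
Proof.
rewrite (_ : character h = fun x => 1 * character h x); last first.
  by apply/funext => x; rewrite mul1r.
apply: cintegrableM_character; split; last exact: integrable0.
exact: (finite_measure_integrable_cst _ 1).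
Qed.

End dim.

End torus_characters.

(** * Orthonormality of the characters *)

Section orthogonality.
Context {R : realType}.
Local Notation Re := (@complex.Re R).
Local Notation Im := (@complex.Im R).
Local Notation mR := (measurableTypeR R).

Lemma integrable_bounded d (T : measurableType d) (P : probability T R)
    (f : T -> R) (B : R) :
  measurable_fun setT f -> (forall x, `|f x| <= B) ->
  P.-integrable setT (EFin \o f).
Proof.
move=> mf fB; apply: measurable_bounded_integrable => //.
  exact: fin_num_fun_lty.
exists B; split; first exact: num_real.
by move=> y By x _ /=; apply: le_trans (fB x) (ltW By).
Qed.

Lemma cintegral1 d (T : measurableType d) (P : probability T R) :
  cintegral P (fun=> 1) = 1.
Proof.
rewrite /cintegral /= /Rintegral integral0 integral_cst//=.
by have -> := probability_setT P; rewrite mule1.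
Qed.

Lemma Rintegral_unit_lebesgue (f F : R -> R) (B : R) :
  continuous f -> (forall x, is_derive (x : R) (1 : R) F (f x)) ->
  (forall x, `|f x| <= B) ->
  \int[unit_lebesgue]_x f x = F 1 - F 0.
Proof.
move=> cf dF fB.
have mf : measurable_fun [set: mR] f by exact: continuous_measurable_fun.
have cF x : {for x, continuous F}.
  by apply: differentiable_continuous; apply/derivable1_diffP; exact: ex_derive.
(* The complement of [0, 1) is null for the restricted measure, and the end
   point 1 for the Lebesgue measure. *)
have -> : \int[unit_lebesgue]_x f x = \int[lebesgue_measure]_(x in `[0, 1]) f x.
  rewrite /Rintegral; congr fine.
  have mI : measurable (`[0, 1[ : set mR) by exact: measurable_itv.
  rewrite (@negligible_integral _ mR _ unit_lebesgue setT
    (~` `[0, 1[%classic))//=; first last.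
  - by rewrite /unit_lebesgue /mrestr setICl measure0.
  - exact: (integrable_bounded unit_lebesgue mf fB).
  - exact: measurableC.
  rewrite setTD setCK (eq_measure_integral lebesgue_measure); last first.
    move=> A mA AI; rewrite /= /unit_lebesgue /mrestr.
    exact: (congr1 lebesgue_measure (setIidl AI)).
  apply: integral_itv_bndo_bndc.
  apply/measurable_EFinP; exact: measurable_funTS.
rewrite /Rintegral (@continuous_FTC2 _ _ F)//.
- exact: continuous_subspaceT.
- split=> [x _||]; first exact: ex_derive.
  + by apply: cvg_at_right_filter; exact: cF.
  + by apply: cvg_at_left_filter; exact: cF.
- by move=> x _; rewrite derive1E; exact: derive_val.
Qed.

Lemma cintegral_character1 (m : int) :
  cintegral unit_lebesgue (fun u : mR => expi2pi (m%:~R * u)) = (m == 0)%:R.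
Proof.
have [->|m0] := eqVneq m 0.
  rewrite (_ : (fun _ => _) = fun=> 1); last first.
    by apply/funext => u; rewrite mul0r expi2pi0.
  exact: cintegral1.
set w : R := 2 * pi * m%:~R.
have w0 : w != 0 by rewrite !mulf_neq0 ?intr_eq0// gt_eqF// pi_gt0.
have wE u : 2 * pi * (m%:~R * u) = w * u by rewrite mulrA.
have perw : expi2pi (m%:~R : R) = 1 by exact: expi2pi_int.
have cosw : cos w = 1 by move/(congr1 Re): perw.
have sinw : sin w = 0 by move/(congr1 Im): perw.
have cw : continuous (fun u : R => w * u).
  by move=> u; apply: cvgM => //; exact: cvg_cst.
have clin (f : R -> R) : continuous f -> continuous (fun u : R => f (w * u)).
  by move=> cf u; exact: (@continuous_comp _ _ _ (fun u => w * u) f u (cw u) (cf _)).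
have dsin x : is_derive (x : R) (1 : R)
    (fun u : R => w^-1 * sin (w * u)) (cos (w * x)).
  by apply: is_derive_eq; rewrite /GRing.scale /= mulr1 mulrCA mulVf// mulr1.
have dcos x : is_derive (x : R) (1 : R)
    (fun u : R => - (w^-1 * cos (w * u))) (sin (w * x)).
  apply: is_derive_eq.
  by rewrite /GRing.scale /= mulr1 mulNr mulrN opprK mulrCA mulVf// mulr1.
rewrite /cintegral; congr Complex => /=.
  under eq_Rintegral do rewrite wE.
  rewrite (Rintegral_unit_lebesgue (clin _ (@continuous_cos R)) dsin (fun=> cos_max _)).
  by rewrite mulr1 mulr0 sinw sin0 !mulr0 subr0.
under eq_Rintegral do rewrite wE.
rewrite (Rintegral_unit_lebesgue (clin _ (@continuous_sin R)) dcos (fun=> sin_max _)).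
by rewrite mulr1 mulr0 cosw cos0 subrr.
Qed.

(** Independence of the two coordinates, for bounded real functions; complex
    products are split into their four real terms. *)
Lemma Rintegral_product d1 d2 (T1 : measurableType d1) (T2 : measurableType d2)
    (P1 : probability T1 R) (P2 : probability T2 R) (f : T1 -> R) (g : T2 -> R) :
  measurable_fun setT f -> measurable_fun setT g ->
  (forall x, `|f x| <= 1) -> (forall y, `|g y| <= 1) ->
  (P1 \x P2)%E.-integrable setT (fun z => (f z.1 * g z.2)%:E) /\
  \int[(P1 \x P2)%E]_z (f z.1 * g z.2) = \int[P1]_x f x * \int[P2]_y g y.
Proof.
move=> mf mg f1 g1.
have ig := integrable_bounded P2 mg g1.
have if_ := integrable_bounded P1 mf f1.
have mfg : measurable_fun setT (fun z : T1 * T2 => f z.1 * g z.2).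
  by apply: measurable_funM; exact: measurableT_comp.
have ifg : (P1 \x P2)%E.-integrable setT (fun z => (f z.1 * g z.2)%:E).
  apply: (@integrable_bounded _ _ (P1 \x P2)%E _ 1) => // z.
  by rewrite normrM mulr_ile1.
split=> //.
rewrite /Rintegral -(integral12_prod_meas1 ifg).
have -> : fubini_F P2 (fun z => (f z.1 * g z.2)%:E) =
    fun x => ((\int[P2]_y g y) * f x)%:E.
  apply/funext => x; rewrite /fubini_F /=.
  transitivity (\int[P2]_y ((f x)%:E * (EFin \o g) y))%E.
    by apply: eq_integral => y _; rewrite /= EFinM.
  rewrite integralZl// -[X in (_ * X)%E]fineK; last exact: integrable_fin_num.
  by rewrite -EFinM mulrC.
transitivity (fine (\int[P1]_x ((\int[P2]_y g y)%:E * (EFin \o f) x))%E).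
  by congr fine; apply: eq_integral => x _; rewrite /= EFinM.
rewrite integralZl// -[X in (_ * X)%E]fineK; last exact: integrable_fin_num.
by rewrite -EFinM/= mulrC.
Qed.

Lemma dotr_row_cons n (h : 'rV[int]_n.+1) (p : mR * 'rV[mR]_n) :
  dotr h (row_cons p) =
  (h ord0 ord0)%:~R * p.1 + dotr (\row_j h ord0 (lift ord0 j)) p.2.
Proof.
rewrite /dotr big_ord_recl mxE unlift_none; congr (_ + _).
by apply: eq_bigr => i _; rewrite !mxE liftK.
Qed.

(** Orthonormality of the characters: by Fubini along the recursive construction
    of the cube measure, the integral factors into one-dimensional ones. *)
Lemma cintegral_character n (h : 'rV[int]_n) :
  cintegral (cell_measure n) (character h) = (h == 0)%:R :> R[i].
Proof.
elim: n h => [|n IHn] h.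
  rewrite (thinmx0 h) eqxx (_ : character 0 = fun=> 1); last first.
    by apply/funext => u; rewrite /character /dotr big_ord0 expi2pi0.
  exact: cintegral1.
pose h' : 'rV_n := \row_j h ord0 (lift ord0 j); pose m := h ord0 ord0.
pose e (u : mR) : R[i] := expi2pi (m%:~R * u).
have He p : character h (row_cons p) = e p.1 * character h' p.2.
  by rewrite /character dotr_row_cons expi2piD.
have lw : measurable_fun [set: mR] (fun u : mR => 2 * pi * (m%:~R * u) : R).
  by apply: measurable_funM => //; apply: measurable_funM.
have mRe : measurable_fun [set: mR] (Re \o e).
  exact: (measurableT_comp measurable_cosR lw).
have mIe : measurable_fun [set: mR] (Im \o e).
  exact: (measurableT_comp measurable_sinR lw).
have bRe (u : R) : `|Re (expi2pi u)| <= 1 by exact: cos_max.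
have bIm (u : R) : `|Im (expi2pi u)| <= 1 by exact: sin_max.
have [iRR RR] := @Rintegral_product _ _ _ _ unit_lebesgue (cell_measure n) _ _
  mRe (@measurable_Re_character _ _ h') (fun=> bRe _) (fun=> bRe _).
have [iII II] := @Rintegral_product _ _ _ _ unit_lebesgue (cell_measure n) _ _
  mIe (@measurable_Im_character _ _ h') (fun=> bIm _) (fun=> bIm _).
have [iRI RI] := @Rintegral_product _ _ _ _ unit_lebesgue (cell_measure n) _ _
  mRe (@measurable_Im_character _ _ h') (fun=> bRe _) (fun=> bIm _).
have [iIR IR] := @Rintegral_product _ _ _ _ unit_lebesgue (cell_measure n) _ _
  mIe (@measurable_Re_character _ _ h') (fun=> bIm _) (fun=> bRe _).
have pushE (G : 'rV[mR]_n.+1 -> R) (H : mR * 'rV[mR]_n -> R) :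
    measurable_fun setT G -> (forall p, G (row_cons p) = H p) ->
    (unit_lebesgue \x cell_measure n)%E.-integrable setT (EFin \o H) ->
    \int[cell_measure n.+1]_x G x = \int[(unit_lebesgue \x cell_measure n)%E]_p H p.
  move=> mG GH iH; rewrite /Rintegral /= integral_distribution/=.
  - by congr fine; apply: eq_integral => p _ /=; rewrite GH.
  - exact/measurable_EFinP.
  - by rewrite (_ : _ \o _ = EFin \o H)//; apply/funext => p /=; rewrite GH.
have hE : (h == 0) = (m == 0) && (h' == 0).
  apply/eqP/andP => [h0|[/eqP m0 /eqP h'0]].
    split; apply/eqP; first by rewrite /m h0 mxE.
    by apply/rowP => j; rewrite mxE h0 !mxE.
  apply/rowP => j; rewrite mxE; case: (unliftP ord0 j) => [k ->|->]; last exact: m0.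
  by move/rowP/(_ k): h'0; rewrite !mxE.
transitivity (cintegral unit_lebesgue e * cintegral (cell_measure n) (character h')).
  have R_ := pushE (Re \o character h) (fun p => Re (e p.1) * Re (character h' p.2)
                           - Im (e p.1) * Im (character h' p.2)).
  have I_ := pushE (Im \o character h) (fun p => Re (e p.1) * Im (character h' p.2)
                           + Im (e p.1) * Re (character h' p.2)).
  apply/eqP; rewrite eq_complex; apply/andP; split; apply/eqP.
    apply: etrans (R_ _ _ _) _.
    - exact: measurable_Re_character.
    - by move=> p; rewrite /comp He; case: (e _) => ? ?; case: (character _ _).
    - exact: (integrableR_sub iRR iII).
    - apply: etrans (RintegralB measurableT iRR iII) _.
      by congr (_ - _); [exact: RR|exact: II].
  apply: etrans (I_ _ _ _) _.
  - exact: measurable_Im_character.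
  - by move=> p; rewrite /comp He; case: (e _) => ? ?; case: (character _ _).
  - exact: (integrableR_add iRI iIR).
  - apply: etrans (RintegralD measurableT iRI iIR) _.
    by congr (_ + _); [exact: RI|exact: IR].
by rewrite IHn cintegral_character1 -natrM mulnb hE.
Qed.

End orthogonality.

(** * Fejer means *)

Section fejer.
Context {R : realType} {d : nat}.
Local Notation Re := (@complex.Re R).
Local Notation Im := (@complex.Im R).
Local Notation mR := (measurableTypeR R).
Local Notation mu := (@cell_measure R d).
Local Notation normc := Normc.normc.
Implicit Types (h k : 'rV[int]_d) (x y u : 'rV[R]_d) (n : nat).

Definition freq n (a : {ffun 'I_d -> 'I_n.+1}) : 'rV[int]_d :=
  \row_j (a j : nat)%:Z.

(** Frequencies are differences of points of a box, and the mean is kept as a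
    double sum: it displays the kernel as a squared modulus, and the mean as an
    average over [a] of sums over distinct frequencies. *)
Definition fejer_mean n (c : 'rV[int]_d -> R[i]) x : R[i] :=
  (#|{ffun 'I_d -> 'I_n.+1}|%:R)^-1 *
  \sum_(a : {ffun 'I_d -> 'I_n.+1}) \sum_(b : {ffun 'I_d -> 'I_n.+1})
    c (freq a - freq b) * character (freq a - freq b) x.

Definition fejer_kernel n u : R :=
  (#|{ffun 'I_d -> 'I_n.+1}|%:R)^-1 *
  normc (\sum_(a : {ffun 'I_d -> 'I_n.+1}) character (freq a) u) ^+ 2.

Lemma freq_inj n : injective (@freq n).
Proof.
move=> a b /rowP ab; apply/ffunP => j; apply: val_inj.
by have := ab j; rewrite !mxE => -[].
Qed.

Lemma card_freq_gt0 n : (0 < #|{ffun 'I_d -> 'I_n.+1}|)%N.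
Proof. by rewrite card_ffun card_ord expn_gt0. Qed.

Lemma fejer_kernel_ge0 n u : 0 <= fejer_kernel n u.
Proof. by rewrite /fejer_kernel mulr_ge0// ?invr_ge0// sqr_ge0. Qed.

Lemma character_addl h k u :
  character (h + k) u = character h u * character k u :> R[i].
Proof. by rewrite /character dotr_addl expi2piD. Qed.

Lemma character_sub h x y :
  character h (x - y) = character h x * character (- h) y :> R[i].
Proof. by rewrite /character dotr_addr dotr_oppr dotr_oppl expi2piD. Qed.

Lemma conjc_character h u : ((character h u)^*)%C = character (- h) u :> R[i].
Proof.
by rewrite /character /expi2pi dotr_oppl /= mulrN cosN sinN.
Qed.

Lemma fejer_kernelE n u : (fejer_kernel n u)%:C%C = fejer_mean n (fun=> 1) u.
Proof.
rewrite /fejer_kernel /fejer_mean rmorphM fmorphV rmorph_nat; congr (_ * _).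
set D := \sum_(a : {ffun _}) _.
transitivity (D * (D^*)%C).
  by rewrite -sqr_normc normc_def rmorphXn; case: D.
have -> : (D^*)%C = \sum_(b : {ffun 'I_d -> 'I_n.+1}) character (- freq b) u.
  rewrite /D (rmorph_sum (@conjc R)); apply: eq_bigr => b _.
  exact: conjc_character.
rewrite /D big_distrl; apply: eq_bigr => a _ /=.
rewrite big_distrr; apply: eq_bigr => b _ /=.
by rewrite mul1r character_addl.
Qed.

Lemma fourier_coefE (F : 'rV[R]_d -> R[i]) h :
  fourier_coef F h = cintegral mu (fun y => F y * character (- h) y).
Proof. by rewrite /character; under eq_fun do rewrite dotr_oppl. Qed.

(** The kernel is a trigonometric polynomial, so expanding it leaves only the
    Fourier coefficients of [F]. *)
Lemma cintegral_fejer n (F : 'rV[mR]_d -> R[i]) x : cintegrable mu F ->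
  cintegrable mu (fun y => F y * (fejer_kernel n (x - y))%:C%C) /\
  cintegral mu (fun y => F y * (fejer_kernel n (x - y))%:C%C) =
  fejer_mean n (fourier_coef F) x.
Proof.
move=> iF; set N : R[i] := (#|{ffun 'I_d -> 'I_n.+1}|%:R)^-1.
have -> : (fun y => F y * (fejer_kernel n (x - y))%:C%C) = fun y =>
    N * \sum_(a : {ffun 'I_d -> 'I_n.+1}) \sum_(b : {ffun 'I_d -> 'I_n.+1})
    (character (freq a - freq b) x * (F y * character (- (freq a - freq b)) y)).
  apply/funext => y; rewrite fejer_kernelE /fejer_mean mulrCA; congr (_ * _).
  rewrite big_distrr; apply: eq_bigr => a _ /=.
  rewrite big_distrr; apply: eq_bigr => b _ /=.
  by rewrite mul1r character_sub mulrCA.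
have i1 (a b : {ffun 'I_d -> 'I_n.+1}) : cintegrable mu (fun y =>
    character (freq a - freq b) x * (F y * character (- (freq a - freq b)) y)).
  by apply: cintegrableZ; exact: cintegrableM_character.
have i2 (a : {ffun 'I_d -> 'I_n.+1}) : cintegrable mu (fun y =>
    \sum_(b : {ffun 'I_d -> 'I_n.+1})
    character (freq a - freq b) x * (F y * character (- (freq a - freq b)) y)).
  exact: cintegrable_sum.
have i3 := cintegrable_sum (index_enum _) i2.
split; first exact: cintegrableZ.
rewrite cintegralZ// cintegral_sum//; congr (_ * _).
apply: eq_bigr => a _; rewrite cintegral_sum//; apply: eq_bigr => b _.
by rewrite cintegralZ ?fourier_coefE 1?mulrC//; exact: cintegrableM_character.
Qed.

Lemma fourier_coef_character k h :
  fourier_coef (character k : 'rV[R]_d -> R[i]) h = (k == h)%:R.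
Proof.
rewrite fourier_coefE.
under eq_fun do rewrite -character_addl.
by rewrite cintegral_character subr_eq0.
Qed.

Lemma fejer_mean_character n k x :
  fejer_mean n (fourier_coef (character k)) x =
  (#|[pred ab : {ffun 'I_d -> 'I_n.+1} * {ffun 'I_d -> 'I_n.+1} |
      freq ab.1 == freq ab.2 + k]|%:R / #|{ffun 'I_d -> 'I_n.+1}|%:R) *
  character k x.
Proof.
rewrite /fejer_mean mulrAC mulrC. congr (_ * _).
rewrite pair_big /= -sum1_card natr_sum big_distrl /= [RHS]big_mkcond /=.
apply: eq_bigr => -[a b] _ /=; rewrite inE /= fourier_coef_character.
rewrite [k == _]eq_sym subr_eq (addrC k).
by case: eqVneq => [->|_]; rewrite ?mul0r// addrAC subrr add0r.
Qed.

End fejer.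

(** * Korovkin domination *)

Section periodic.
Context {R : realType} {d : nat}.
Implicit Types (x y : 'rV[R]_d) (phi : 'rV[R]_d -> R).

Lemma periodic_bounded phi : continuous phi ->
  (forall x k, phi (x + int_row k) = phi x) ->
  exists2 B, 0 <= B & forall x, `|phi x| <= B.
Proof.
move=> cphi per.
pose cube := [set x : 'rV[R]_d | forall i, `[0, 1]%classic (x ord0 i)].
have ccube : compact cube.
  exact: (@rV_compact R d (fun=> `[0, 1]%classic) (fun=> @segment_compact R 0 1)).
have := continuous_compact (continuous_subspaceT cphi) ccube.
move/compact_bounded => -[M [_ HM]].
have M1 : M < `|M| + 1 by rewrite (le_lt_trans (ler_norm M))// ltrDl.
exists (`|M| + 1) => [|x]; first by rewrite addr_ge0.
pose k : 'rV[int]_d := \row_i - Num.floor (x ord0 i).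
have -> : phi x = phi (x + int_row k) by rewrite per.
have := HM _ M1; rewrite /globally /=; apply; exists (x + int_row k) => //= i.
rewrite !mxE rmorphN /= in_itv /=.
have /andP[h1 h2] := floor_itv (x ord0 i); rewrite subr_ge0 h1 /=.
by rewrite lerBlDl (le_trans (ltW h2))// intrD.
Qed.

(** Korovkin's domination: off a small neighbourhood of [x] modulo the integer
    lattice, some [1 - cos] stays away from 0, so that one can pay there for the
    bounded difference. *)
Lemma korovkin_domination phi x eps : continuous phi ->
  (forall x k, phi (x + int_row k) = phi x) -> 0 < eps ->
  exists2 C, 0 <= C & forall y, `|phi y - phi x| <=
    eps + C * \sum_j (1 - cos (2 * pi * (y ord0 j - x ord0 j))).
Proof.
move=> cphi per eps0; have [B B0 hB] := periodic_bounded cphi per.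
have /nbhs_ballP[del /= del0 hdel] : \forall y \near x, `|phi x - phi y| < eps.
  by move/cvgrPdist_lt : (cphi x); apply.
(* The radius is capped by 1/2: beyond it [1 - cos (2 * pi * t)] decreases again. *)
pose dl := Num.min del 2^-1.
have dl0 : 0 < dl.
  by rewrite /dl lt_min; apply/andP; split; [exact: del0|rewrite invr_gt0 ltr0n].
have dl2 : dl <= 2^-1 by rewrite /dl ge_min lexx orbT.
have pi2 t : 0 <= t <= 2^-1 -> 2 * pi * t \in `[0, pi : R].
  move=> /andP[t0 t1]; rewrite in_itv /=; have p0 := pi_gt0 R; apply/andP; split; nra.
have cdl : cos (2 * pi * dl) < 1.
  rewrite -[ltRHS]cos0 ltr_cos; first by rewrite mulr_gt0// mulr_gt0// pi_gt0.
  - by rewrite in_itv /= lexx pi_ge0.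
  - by rewrite pi2// (ltW dl0) dl2.
exists (2 * B / (1 - cos (2 * pi * dl))) => [|y].
  by rewrite divr_ge0 ?mulr_ge0// subr_ge0 ltW.
(* Translating [y] by [k] rounds every coordinate of [y - x] into [-1/2, 1/2). *)
pose k : 'rV[int]_d := \row_i - Num.floor (y ord0 i - x ord0 i + 2^-1).
pose u i : R := y ord0 i - x ord0 i + (k ord0 i)%:~R.
have hu i : `|u i| <= 2^-1.
  rewrite /u mxE rmorphN /=.
  have /andP[h1 h2] := floor_itv (y ord0 i - x ord0 i + 2^-1).
  rewrite intrD in h2; rewrite ler_norml; apply/andP; split; lra.
have cosE i : cos (2 * pi * (y ord0 i - x ord0 i)) = cos (2 * pi * `|u i|).
  have <- : cos (2 * pi * u i) = cos (2 * pi * `|u i|).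
    by rewrite -cos_norm normrM ger0_norm ?mulr_ge0 ?pi_ge0.
  have /(congr1 (@complex.Re R)) : expi2pi (u i) = expi2pi (y ord0 i - x ord0 i).
    by rewrite /u expi2piD expi2pi_int mulr1.
  by [].
have cos1 i : 0 <= 1 - cos (2 * pi * (y ord0 i - x ord0 i)).
  by rewrite subr_ge0 cos_le1.
have S0 : 0 <= \sum_j (1 - cos (2 * pi * (y ord0 j - x ord0 j))).
  by apply: sumr_ge0 => i _.
have C0 : 0 <= 2 * B / (1 - cos (2 * pi * dl)).
  by rewrite divr_ge0 ?mulr_ge0// subr_ge0 ltW.
have [near_|[i far]] : (forall i, `|u i| < dl) \/ exists i, dl <= `|u i|.
  have [/existsP[i hi]|/existsPn hn] := boolP [exists i, dl <= `|u i|].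
    by right; exists i.
  by left=> i; rewrite ltNge hn.
- rewrite -(per y k) distrC (le_trans (ltW (hdel _ _)))//.
    split=> // i j; rewrite ord1 -ball_normE /= distrC.
    rewrite (_ : _ - _ = u j); last by rewrite /u !mxE; lra.
    by rewrite (lt_le_trans (near_ j))// /dl ge_min lexx.
  by rewrite lerDl mulr_ge0.
- have := ler_normB (phi y) (phi x); have := hB x; have := hB y.
  move=> h1 h2 h3.
  have hS : 1 - cos (2 * pi * dl) <= \sum_j (1 - cos (2 * pi * (y ord0 j - x ord0 j))).
    rewrite (bigD1 i)//= cosE -[leLHS]addr0 lerD ?sumr_ge0// lerB//.
    move: far; rewrite le_eqVlt => /predU1P[->//|far].
    rewrite ltW// ltr_cos ?pi2 ?hu ?normr_ge0 ?dl2 ?(ltW dl0)// ltr_pM2l//.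
    by rewrite mulr_gt0 ?pi_gt0.
  have : 2 * B <= 2 * B / (1 - cos (2 * pi * dl)) *
      \sum_j (1 - cos (2 * pi * (y ord0 j - x ord0 j))).
    rewrite -mulrA ler_peMr ?mulr_ge0// mulrC ler_pdivlMr ?mul1r//.
    by rewrite subr_gt0.
  lra.
Qed.

End periodic.

(** * Convergence of the Fejer means *)

Section fejer_moments.
Context {R : realType} {d : nat}.
Implicit Types (n : nat) (j : 'I_d).
Local Notation box n := {ffun 'I_d -> 'I_n.+1}.

(** Overwriting the coordinate [j] sends ['I_n.+1] times the face injectively
    into the box. *)
Lemma card_box_face n j :
  (n.+1 * #|[pred b : box n | b j == ord_max]| <= #|box n|)%N.
Proof.
pose repl (p : 'I_n.+1 * box n) : box n := [ffun i => if i == j then p.1 else p.2 i].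
pose D := [predX (predT : pred 'I_n.+1) & [pred b : box n | b j == ord_max]].
have injD : {in D &, injective repl}.
  move=> [u b] [v c]; rewrite !inE /= => /eqP bj /eqP cj /ffunP uv.
  have uvj := uv j; rewrite !ffunE eqxx /= in uvj.
  congr (_, _) => //; apply/ffunP => i; have := uv i; rewrite !ffunE /=.
  by case: eqP => // -> _; rewrite bj cj.
rewrite -{1}(card_ord n.+1) -cardX -(card_in_image injD).
exact: max_card.
Qed.

(** Only the points of the last face leave the box when shifted by a unit
    vector. *)
Lemma card_box_shift n j :
  (#|[pred b : box n | b j != ord_max]| <=
   #|[pred ab : box n * box n | freq ab.1 == (freq ab.2 + delta_mx 0 j)%R]|)%N.
Proof.
pose up (b : box n) : box n := [ffun i => if i == j then inord (b j).+1 else b i].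
have injf : injective (fun b : box n => (up b, b)) by move=> b c [].
rewrite -(fintype.card_image injf); apply: subset_leq_card; apply/fintype.subsetP => ab.
move=> /fintype.imageP[b]; rewrite inE => bj ->; rewrite inE /=.
apply/eqP/rowP => i; rewrite !mxE eqxx /= ffunE.
case: eqVneq => [->|]; last by rewrite addr0.
rewrite inordK ?intS 1?addrC// ltnS ltn_neqAle -ltnS ltn_ord andbT.
by apply: contraNneq bj => bn; apply/eqP/val_inj.
Qed.

Lemma fejer_first_coef n j :
  1 - (n.+1%:R)^-1 <=
  #|[pred ab : box n * box n | freq ab.1 == (freq ab.2 + delta_mx 0 j)%R]|%:R /
  #|box n|%:R :> R.
Proof.
have N0 : 0 < #|box n|%:R :> R by rewrite ltr0n card_freq_gt0.
have H := card_box_shift n j; have F := card_box_face n j.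
have C := cardC [pred b : box n | b j == ord_max].
have H' : (#|box n| <= #|[pred b : box n | b j == ord_max]| +
   #|[pred ab : box n * box n | freq ab.1 == (freq ab.2 + delta_mx 0 j)%R]|)%N.
  rewrite -C leq_add2l; apply: leq_trans H; apply: eq_leq; exact: eq_card.
rewrite ler_pdivlMr// mulrBl mul1r lerBlDl.
have : (#|box n|%:R : R) <= #|[pred b : box n | b j == ord_max]|%:R +
   #|[pred ab : box n * box n | freq ab.1 == (freq ab.2 + delta_mx 0 j)%R]|%:R.
  by rewrite -natrD ler_nat.
move/le_trans; apply; rewrite lerD2r mulrC ler_pdivlMr ?ltr0n// -natrM ler_nat.
by rewrite mulnC.
Qed.

End fejer_moments.

Section fejer_convergence.
Context {R : realType} {d : nat}.
Local Notation Re := (@complex.Re R).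
Local Notation Im := (@complex.Im R).
Local Notation mR := (measurableTypeR R).
Local Notation mu := (@cell_measure R d).
Local Notation normc := Normc.normc.
Local Notation K := (@fejer_kernel R d).
Implicit Types (x y : 'rV[R]_d).

Lemma fejer_mean_one n x : fejer_mean n (fourier_coef (fun=> 1)) x = 1 :> R[i].
Proof.
have E : (fun=> 1) = character 0 :> ('rV[R]_d -> R[i]).
  apply/funext => y; rewrite /character /dotr big1 ?expi2pi0// => i _.
  by rewrite mxE mul0r.
rewrite E fejer_mean_character -E mulr1.
rewrite (_ : #|_| = #|{ffun 'I_d -> 'I_n.+1}|).
  by rewrite divff// pnatr_eq0 -lt0n card_freq_gt0.
have inj : injective (fun b : {ffun 'I_d -> 'I_n.+1} => (b, b)) by move=> b c [].
rewrite -(fintype.card_image inj predT); apply: eq_card => -[a b]; rewrite inE /= addr0.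
apply/eqP/fintype.imageP => [/freq_inj ->|[c _ [-> ->]]//]; by exists b.
Qed.

Lemma cintegrable_one : cintegrable mu (fun=> 1).
Proof.
split; last exact: integrable0.
exact: (finite_measure_integrable_cst _ 1).
Qed.

Lemma fejer_mass n x :
  mu.-integrable setT (fun y : 'rV[mR]_d => (K n (x - y))%:E) /\
  \int[mu]_y K n (x - y) = 1.
Proof.
have [[iK _] E] := cintegral_fejer n x cintegrable_one.
have KE (y : 'rV[mR]_d) : Re (1 * (K n (x - y))%:C%C) = K n (x - y).
  by rewrite mul1r.
split.
  rewrite (_ : (fun _ => _) = EFin \o Re \o (fun y => 1 * (K n (x - y))%:C%C))//.
  by apply/funext => y /=; rewrite mul1r mulr0 subr0.
move: E; rewrite fejer_mean_one => /(congr1 Re) /= <-.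
by apply: eq_Rintegral => y _; rewrite mul1r mulr0 subr0.
Qed.

(** The function integrated against the kernel is the real part of a character
    of [y - x], so its integral is the first coefficient of the kernel. *)
Lemma fejer_first_moment n x (j : 'I_d) :
  let g y := (1 - cos (2 * pi * (y ord0 j - x ord0 j))) * K n (x - y) in
  mu.-integrable setT (fun y : 'rV[mR]_d => (g y)%:E) /\
  \int[mu]_y g y <= (n.+1%:R)^-1.
Proof.
move=> g; pose k : 'rV[int]_d := delta_mx 0 j.
have kE u : dotr k u = u ord0 j.
  rewrite /dotr (bigD1 j)//= big1 => [|i ij].
    by rewrite addr0 mxE !eqxx mul1r.
  by rewrite mxE eqxx (negbTE ij) mul0r.
pose F (y : 'rV[mR]_d) : R[i] := character k y.
have iF : cintegrable mu F by exact: cintegrable_character.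
have [iFK E] := cintegral_fejer n x iF.
have [iK K1] := fejer_mass n x.
pose c := (#|[pred ab : {ffun 'I_d -> 'I_n.+1} * {ffun 'I_d -> 'I_n.+1} |
  freq ab.1 == freq ab.2 + k]|%:R / #|{ffun 'I_d -> 'I_n.+1}|%:R : R).
have cE : cintegral mu (fun y => character (- k) x * (F y * (K n (x - y))%:C%C)) =
    c%:C%C.
  rewrite cintegralZ// E fejer_mean_character mulrCA -character_addl addNr.
  rewrite (_ : character 0 x = 1) ?mulr1.
    by rewrite /c rmorphM fmorphV !rmorph_nat.
  by rewrite /character /dotr big1 ?expi2pi0// => i _; rewrite mxE mul0r.
have [iG _] := cintegrableZ (character (- k) x) iFK.
have GE (y : 'rV[mR]_d) : Re (character (- k) x * (F y * (K n (x - y))%:C%C)) =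
    cos (2 * pi * (y ord0 j - x ord0 j)) * K n (x - y).
  rewrite mulrA /F /character -expi2piD dotr_oppl !kE addrC /expi2pi /=.
  by rewrite mulr0 subr0.
have iG' : mu.-integrable setT (fun y : 'rV[mR]_d =>
    (cos (2 * pi * (y ord0 j - x ord0 j)) * K n (x - y))%:E).
  move: iG; rewrite (_ : _ \o _ = fun y : 'rV[mR]_d =>
    (cos (2 * pi * (y ord0 j - x ord0 j)) * K n (x - y))%:E)//.
  by apply/funext => y; rewrite /= -GE.
have gE y : g y = K n (x - y) - cos (2 * pi * (y ord0 j - x ord0 j)) * K n (x - y).
  by rewrite /g mulrBl mul1r.
rewrite (_ : (fun y => (g y)%:E) = fun y : 'rV[mR]_d => (K n (x - y) -
  cos (2 * pi * (y ord0 j - x ord0 j)) * K n (x - y))%:E); last first.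
  by apply/funext => y; rewrite gE.
split; first exact: (integrableR_sub iK iG').
under eq_Rintegral do rewrite gE.
rewrite RintegralB// K1 lerBlDr -lerBlDl.
have -> : \int[mu]_y (cos (2 * pi * (y ord0 j - x ord0 j)) * K n (x - y)) = c.
  have := congr1 Re cE => /= <-.
  by apply: eq_Rintegral => y _; rewrite -GE.
exact: fejer_first_coef.
Qed.

Lemma ae_le_Rintegral (f1 f2 : 'rV[mR]_d -> R) :
  mu.-integrable setT (EFin \o f1) -> mu.-integrable setT (EFin \o f2) ->
  (forall y, 0 <= f1 y) -> (forall y, 0 <= f2 y) ->
  {ae mu, forall y, f1 y <= f2 y} -> \int[mu]_y f1 y <= \int[mu]_y f2 y.
Proof.
move=> i1 i2 f10 f20 f12; rewrite /Rintegral fine_le//.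
- exact: (integrable_fin_num measurableT i1).
- exact: (integrable_fin_num measurableT i2).
apply: ae_ge0_le_integral => //.
- by move=> y _; rewrite lee_fin.
- exact: measurable_int i1.
- by move=> y _; rewrite lee_fin.
- exact: measurable_int i2.
have aeF := @ae_filter_ringOfSetsType _ _ _ mu.
by apply: filterS f12 => y f12 _; rewrite lee_fin.
Qed.

(** [psi] stands for a part of the integrable function and [phi] for the
    corresponding part of its representative.  The difference [psi y - phi x] is
    compared with the Korovkin majorant almost everywhere, and the integral of
    the majorant against the kernel is at most [eps / 2 + C * d / n.+1]. *)
Lemma fejer_real_cvg (psi phi : 'rV[mR]_d -> R) x :
  continuous (phi : 'rV[R]_d -> R) ->
  (forall y k, phi (y + int_row k) = phi y) ->
  {ae mu, forall y, psi y = phi y} ->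
  (forall n, mu.-integrable setT (fun y : 'rV[mR]_d => (psi y * K n (x - y))%:E)) ->
  \int[mu]_y (psi y * K n (x - y)) @[n --> \oo] --> phi x.
Proof.
move=> cphi per aepsi ipsiK; apply/cvgrPdist_le => /= eps eps0.
have [C C0 dom] := korovkin_domination x cphi per (divr_gt0 eps0 (ltr0Sn R 1)).
near=> n.
pose K' (y : 'rV[mR]_d) : R := K n (x - y).
pose cs j (y : 'rV[mR]_d) : R := (1 - cos (2 * pi * (y ord0 j - x ord0 j))) * K' y.
have [iK K1] := fejer_mass n x.
have K0 y : 0 <= K' y by exact: fejer_kernel_ge0.
have cs0 j y : 0 <= cs j y by rewrite mulr_ge0// subr_ge0 cos_le1.
have ics j : mu.-integrable setT (EFin \o cs j) by have [] := fejer_first_moment n x j.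
have cs1 j : \int[mu]_y cs j y <= (n.+1%:R)^-1 by have [] := fejer_first_moment n x j.
pose f1 (y : 'rV[mR]_d) := `|psi y * K' y - phi x * K' y|.
pose f2 (y : 'rV[mR]_d) := eps / 2 * K' y + C * \sum_j cs j y.
have iK' : mu.-integrable setT (EFin \o K') by exact: iK.
have id : mu.-integrable setT (EFin \o (fun y => psi y * K' y - phi x * K' y)).
  by apply: integrableR_sub (ipsiK n) _; exact: integrableR_scale.
have if1 : mu.-integrable setT (EFin \o f1) by exact: (integrable_norm id).
have [isum sumE] : mu.-integrable setT (EFin \o (fun y => \sum_j cs j y)) /\
    \int[mu]_y (\sum_j cs j y) = \sum_j \int[mu]_y cs j y.
  elim: (index_enum _) => [|j s [IH1 IH2]].
    under [in X in _ /\ X]eq_Rintegral do rewrite big_nil.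
    rewrite big_nil /Rintegral integral0; split=> //.
    by under eq_fun do rewrite /= big_nil; exact: integrable0.
  split.
    rewrite (_ : EFin \o _ = EFin \o (fun y => cs j y + \sum_(i <- s) cs i y)).
      exact: integrableR_add.
    by apply/funext => y /=; rewrite big_cons.
  under eq_Rintegral do rewrite big_cons.
  by rewrite RintegralD// IH2 big_cons.
have if2 : mu.-integrable setT (EFin \o f2).
  by apply: integrableR_add; exact: integrableR_scale.
rewrite distrC -[X in _ - X]mulr1 -K1 -RintegralZl// -RintegralB//; first last.
- exact: integrableR_scale.
- exact: ipsiK.
apply: le_trans (le_normr_Rintegral measurableT id) _.
apply: le_trans (ae_le_Rintegral if1 if2 _ _ _) _.
- by move=> y; exact: normr_ge0.
- move=> y; apply: addr_ge0; apply: mulr_ge0 => //; last exact: sumr_ge0.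
  by rewrite divr_ge0// ltW.
- have aeF := @ae_filter_ringOfSetsType _ _ _ mu.
  apply: filterS aepsi => y; rewrite /f1 => ->.
  rewrite -mulrBl normrM (ger0_norm (K0 y)).
  apply: le_trans (ler_wpM2r (K0 y) (dom y)) _.
  by rewrite /f2 mulrDl lerD2l -[C * _ * _]mulrA mulr_suml.
rewrite RintegralD//; [|exact: integrableR_scale..].
have -> : \int[mu]_y (eps / 2 * K' y) = eps / 2.
  by rewrite (RintegralZl _ measurableT iK') [X in _ * X]K1 mulr1.
rewrite (RintegralZl _ measurableT isum) sumE.
have : C * \sum_j \int[mu]_y cs j y <= C * (d%:R / n.+1%:R).
  rewrite ler_wpM2l//; apply: le_trans (ler_sum _ (fun j _ => cs1 j)) _.
  by rewrite sumr_const card_ord mulr_natl.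
have : C * (d%:R / n.+1%:R) <= eps / 2.
  rewrite mulrA ler_pdivrMr ?ltr0n// [leRHS]mulrC -ler_pdivrMr ?divr_gt0//.
  apply: (@le_trans _ _ n%:R); last by rewrite ler_nat.
  near: n; exact: nbhs_infty_ger.
by move=> h1 h2; rewrite [leRHS]splitr lerD2l (le_trans h2 h1).
Unshelve. all: by end_near. Qed.

(** Point values of the continuous representative are limits of Fejer means,
    although these are computed from the Fourier coefficients of [f] only. *)
Lemma fejer_mean_cvg (f g : 'rV[R]_d -> R[i]) x :
  cintegrable mu (f : 'rV[mR]_d -> R[i]) -> continuous_representative f g ->
  normc (fejer_mean n (fourier_coef f) x - g x) @[n --> \oo] --> (0 : R).
Proof.
move=> cif [per [cRe cIm] aefg].
have fejer_part (part : R[i] -> R) : continuous (part \o g) ->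
    (forall z r, part (z * r%:C%C) = part z * r) ->
    (forall F : 'rV[mR]_d -> R[i], cintegrable mu F ->
      mu.-integrable setT (EFin \o part \o F) /\
      part (cintegral mu F) = \int[mu]_y part (F y)) ->
    part (fejer_mean n (fourier_coef f) x) @[n --> \oo] --> part (g x).
  move=> cpart partM partI.
  have E n : part (fejer_mean n (fourier_coef f) x) =
      \int[mu]_y ((part \o f) y * K n (x - y)).
    have [iFK <-] := cintegral_fejer n x cif.
    by rewrite (partI _ iFK).2; apply: eq_Rintegral => y _; rewrite partM.
  under eq_cvg do rewrite E.
  apply: (fejer_real_cvg (phi := part \o g)) => //.
  - by move=> y k /=; rewrite per.
  - have aeF := @ae_filter_ringOfSetsType _ _ _ mu.
    by apply: filterS aefg => y /= ->.
  - move=> n; have [iFK _] := cintegral_fejer n x cif.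
    have [iP _] := partI _ iFK.
    by move: iP; congr integrable; apply/funext => y /=; rewrite partM.
have cvRe : Re (fejer_mean n (fourier_coef f) x) @[n --> \oo] --> Re (g x).
  apply: fejer_part => // [[a b] r|F [iF _]]; last by split.
  by rewrite /= mulr0 subr0.
have cvIm : Im (fejer_mean n (fourier_coef f) x) @[n --> \oo] --> Im (g x).
  apply: fejer_part => // [[a b] r|F [_ iF]]; last by split.
  by rewrite /= mulr0 add0r.
have normc_le z : normc z <= `|Re z| + `|Im z|.
  case: z => a b /=; rewrite -[leRHS]ger0_norm ?addr_ge0// -sqrtr_sqr.
  have ab := mulr_ge0 (normr_ge0 a) (normr_ge0 b).
  by rewrite ler_wsqrtr// sqrrD !real_normK ?num_real// mulr2n; lra.
apply/cvgrPdist_le => /= eps eps0.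
have e2 : 0 < eps / 2 by rewrite divr_gt0.
move/cvgrPdist_le : cvRe => /(_ _ e2) nRe.
move/cvgrPdist_le : cvIm => /(_ _ e2) nIm.
near=> n; rewrite sub0r normrN ger0_norm ?sqrtr_ge0//; last first.
  by case: (_ - _) => a b; exact: sqrtr_ge0.
apply: le_trans (normc_le _) _; rewrite !raddfB /=.
rewrite [leRHS]splitr lerD// distrC; [near: n; exact: nRe|near: n; exact: nIm].
Unshelve. all: by end_near. Qed.

End fejer_convergence.

(** * Exactness and stability of the lattice rule *)

Lemma le_cvg0 (R : realType) (v b : R) (E : R^nat) :
  E n @[n --> \oo] --> (0 : R) -> (forall n, v <= b + E n) -> v <= b.
Proof.
move=> E0 vE; apply/ler_addgt0Pr => eps eps0.
move/cvgrPdist_le : E0 => /(_ _ eps0) [n _ /(_ n (leqnn n))] /=.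
rewrite sub0r normrN => En; apply: le_trans (vE n) _.
by rewrite lerD2l (le_trans (ler_norm _)).
Qed.

Section lattice_rule.
Context {R : realType} {d L : nat}.
Local Notation normc := Normc.normc.
Variables (z : 'I_L -> 'rV[int]_d) (M : 'I_L -> nat) (I : set 'rV[int]_d).
Hypothesis M_gt0 : forall l, (1 <= M l)%N.
Hypothesis finI : finite_set I.
Hypothesis coverI : I = \bigcup_(l in [set: 'I_L]) alias_free_part z M I l.
Implicit Types (h k : 'rV[int]_d) (x : 'rV[R]_d) (f g : 'rV[R]_d -> R[i]).

Lemma dotr_node k l j :
  dotr k (lattice_node z M l j) = j%:R / (M l)%:R * (dotz k (z l))%:~R :> R.
Proof.
rewrite /dotr /dotz rmorph_sum mulr_sumr; apply: eq_bigr => i _.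
by rewrite !mxE rmorphM mulrCA.
Qed.

Lemma lattice_coef_character k l h :
  lattice_coef z M (character k : _ -> R[i]) l h =
  (dotz h (z l) == dotz k (z l) %[mod M l])%Z%:R.
Proof.
have M0 : (M l)%:R != 0 :> R[i] by rewrite pnatr_eq0 -lt0n.
rewrite /lattice_coef; apply: (mulfI M0); rewrite mulVKf//.
rewrite -natrM eq_sym eqz_mod_dvd -sum_expi2pi//.
apply: eq_bigr => j _; rewrite /character -expi2piD dotr_node; congr expi2pi.
by rewrite rmorphB /=; ring.
Qed.

Lemma finite_part l : finite_set (alias_free_part z M I l).
Proof. by apply: sub_finite_set finI => h [[]]. Qed.

Lemma lattice_approxE f x : lattice_approx z M I f x =
  \sum_(l < L) \sum_(h <- fset_set (alias_free_part z M I l))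
    lattice_coef z M f l h * character h x.
Proof.
apply: eq_bigr => l _; rewrite fsbig_finite//; exact: finite_part.
Qed.

Lemma alias_free_part_unique l h h' :
  alias_free_part z M I l h -> I h' ->
  (dotz h (z l) == dotz h' (z l) %[mod M l])%Z -> h' = h.
Proof.
move=> [_ free] Ih' e; apply/eqP; apply: contraT => ne.
by have := free _ Ih' ne; rewrite e.
Qed.

Lemma alias_free_part_disjoint k l l' :
  alias_free_part z M I l k -> alias_free_part z M I l' k -> l = l'.
Proof.
have lt_absurd (l1 l2 : 'I_L) : (l1 < l2)%N ->
    alias_free_part z M I l1 k -> ~ alias_free_part z M I l2 k.
  by move=> lt12 k1 [[_ nc] _]; apply: nc; rewrite coveredE; exists l1.
move=> kl kl'; case: (ltngtP l l') => [lt|lt|/val_inj//].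
  by have := lt_absurd _ _ lt kl kl'.
by have := lt_absurd _ _ lt kl' kl.
Qed.

(** Two frequencies of one part that alias with [k] alias with each other, so
    the part contributes at most one character; it contributes nothing only if
    it does not contain [k], which aliases with itself. *)
Lemma lattice_part_character k l x :
  let s := \sum_(h <- fset_set (alias_free_part z M I l))
     lattice_coef z M (character k : _ -> R[i]) l h * character h x in
  (exists h, [/\ alias_free_part z M I l h,
     (dotz h (z l) == dotz k (z l) %[mod M l])%Z & s = character h x]) \/
  (s = 0 /\ ~ alias_free_part z M I l k).
Proof.
move=> s; pose al h := (dotz h (z l) == dotz k (z l) %[mod M l])%Z.
have memP h : (h \in fset_set (alias_free_part z M I l)) =
    (h \in alias_free_part z M I l) by rewrite in_fset_set//; exact: finite_part.
have [/hasP[h hin alh]|/hasPn nal] :=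
  boolP (has al (fset_set (alias_free_part z M I l))).
  have hl : alias_free_part z M I l h by move: hin; rewrite memP inE.
  left; exists h; split=> //.
  rewrite /s (bigD1_seq h hin (fset_uniq _)) lattice_coef_character -/(al h) alh mul1r.
  rewrite big1_seq => [|h' /andP[ne h'in]]; first exact: addr0.
  rewrite lattice_coef_character -/(al h').
  have [alh'|] := boolP (al h'); last by rewrite mul0r.
  have h'l : alias_free_part z M I l h' by move: h'in; rewrite memP inE.
  have h'h : h' = h.
    apply: alias_free_part_unique hl _ _ => //; first by case: h'l => -[].
    by rewrite (eqP alh) eq_sym.
  by rewrite h'h eqxx in ne.
right; split=> [|kl].
  rewrite /s big1_seq// => h /andP[_ hin].
  by rewrite lattice_coef_character -/(al h) (negbTE (nal _ hin)) mul0r.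
have : k \in fset_set (alias_free_part z M I l) by rewrite memP inE.
by move/nal; rewrite /al eqxx.
Qed.

Lemma lattice_approx_exact k x :
  I k -> lattice_approx z M I (character k) x = character k x.
Proof.
move=> Ik; have [l0 _ kl0] : (\bigcup_(l in [set: 'I_L]) alias_free_part z M I l) k.
  by rewrite -coverI.
rewrite lattice_approxE (bigD1 l0)//= [X in _ + X]big1 ?addr0 => [|l ne].
  case: (lattice_part_character k l0 x) => [[h [hl al ->]]|[_ /(_ kl0)//]].
  by rewrite (alias_free_part_unique (h' := k) hl).
case: (lattice_part_character k l x) => [[h [hl al _]]|[-> //]].
have kh : k = h by apply: alias_free_part_unique hl Ik al.
by rewrite -kh in hl; move: ne; rewrite (alias_free_part_disjoint hl kl0) eqxx.
Qed.

Lemma normc_lattice_approx_character k x :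
  normc (lattice_approx z M I (character k) x) <= L%:R.
Proof.
rewrite lattice_approxE; apply: le_trans (normc_sum _ _) _.
have -> : L%:R = \sum_(l < L) 1 :> R by rewrite sumr_const card_ord.
apply: ler_sum => l _.
case: (lattice_part_character k l x) => [[h [_ _ ->]]|[-> _]].
  by rewrite normc_expi2pi.
by rewrite Normc.normc0.
Qed.

Lemma lattice_coef_sum (J : Type) (s : seq J) (w : J -> R[i])
    (F : J -> 'rV[R]_d -> R[i]) l h :
  lattice_coef z M (fun x => \sum_(i <- s) w i * F i x) l h =
  \sum_(i <- s) w i * lattice_coef z M (F i) l h.
Proof.
rewrite /lattice_coef; under eq_bigr do rewrite big_distrl /=.
rewrite exchange_big /= big_distrr /=; apply: eq_bigr => i _.
rewrite mulrCA; congr (_ * _); rewrite big_distrr /=.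
by apply: eq_bigr => j _; rewrite mulrA.
Qed.

Lemma lattice_approx_sum (J : Type) (s : seq J) (w : J -> R[i])
    (F : J -> 'rV[R]_d -> R[i]) x :
  lattice_approx z M I (fun x => \sum_(i <- s) w i * F i x) x =
  \sum_(i <- s) w i * lattice_approx z M I (F i) x.
Proof.
rewrite lattice_approxE.
transitivity (\sum_(l < L) \sum_(i <- s)
    w i * \sum_(h <- fset_set (alias_free_part z M I l))
    lattice_coef z M (F i) l h * character h x).
  apply: eq_bigr => l _; under eq_bigr do rewrite lattice_coef_sum big_distrl /=.
  rewrite exchange_big /=; apply: eq_bigr => i _; rewrite big_distrr /=.
  by apply: eq_bigr => h _; rewrite mulrA.
rewrite exchange_big /=; apply: eq_bigr => i _.
by rewrite lattice_approxE big_distrr.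
Qed.

(** The total of the sampling errors that enter [lattice_approx], with the
    phases dropped. *)
Definition node_error f g : R :=
  \sum_(l < L) \sum_(h <- fset_set (alias_free_part z M I l))
    (M l)%:R^-1 * \sum_(j < M l)
      normc (f (lattice_node z M l j) - g (lattice_node z M l j)).

Lemma normc_lattice_approxB f g x :
  normc (lattice_approx z M I f x - lattice_approx z M I g x) <= node_error f g.
Proof.
rewrite !lattice_approxE -sumrB; apply: le_trans (normc_sum _ _) _.
apply: ler_sum => l _; rewrite -sumrB; apply: le_trans (normc_sum _ _) _.
apply: ler_sum => h _; rewrite -mulrBl Normc.normcM normc_expi2pi mulr1.
rewrite /lattice_coef -mulrBr Normc.normcM Normc.normcV normc_nat ler_wpM2l ?invr_ge0//.
rewrite -sumrB; apply: le_trans (normc_sum _ _) _.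
by apply: ler_sum => j _; rewrite -mulrBl Normc.normcM normc_expi2pi mulr1.
Qed.

Variables (c : 'rV[int]_d -> R[i]) (B : R).
Hypothesis cB : forall s : seq 'rV[int]_d, uniq s ->
  (forall h, h \in s -> ~ I h) -> \sum_(h <- s) normc (c h) <= B.

(** In the double sum defining the mean, the terms with [a - b] in [I] are
    reproduced exactly; for a fixed [a] the other frequencies are distinct, so
    the bound [B] applies, and it survives averaging over [a]. *)
Lemma fejer_mean_lattice_error n x :
  normc (fejer_mean n c x - lattice_approx z M I (fejer_mean n c) x) <=
  (1 + L%:R) * B.
Proof.
pose box := {ffun 'I_d -> 'I_n.+1}.
pose w (p : box * box) : R[i] := (#|{: box}|%:R)^-1 * c (freq p.1 - freq p.2).
pose e (p : box * box) : 'rV[R]_d -> R[i] := character (freq p.1 - freq p.2).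
have PE : fejer_mean n c = fun y => \sum_(p : box * box) w p * e p y.
  apply/funext => y; rewrite /fejer_mean pair_big big_distrr /=.
  by apply: eq_bigr => p _; rewrite mulrA.
rewrite PE lattice_approx_sum -sumrB; apply: le_trans (normc_sum _ _) _.
pose out h : bool := `[< ~ I h >].
have L0 : 0 <= 1 + L%:R :> R by rewrite addr_ge0.
have term p : normc (w p * e p x - w p * lattice_approx z M I (e p) x) <=
    (1 + L%:R) * ((#|{: box}|%:R)^-1 * (if out (freq p.1 - freq p.2)
      then normc (c (freq p.1 - freq p.2)) else 0)).
  rewrite -mulrBr Normc.normcM /w Normc.normcM Normc.normcV normc_nat mulrC.
  have [oh|/asboolPn/contrapT i] := boolP (out _); last first.
    by rewrite lattice_approx_exact// subrr Normc.normc0 !mul0r !mulr0.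
  rewrite ler_wpM2r//.
    by rewrite mulr_ge0 ?invr_ge0//; case: (c _) => ? ?; exact: sqrtr_ge0.
  apply: le_trans (le_normcD _ _) _; rewrite normcN lerD//.
    by rewrite normc_expi2pi.
  exact: normc_lattice_approx_character.
apply: le_trans (ler_sum _ (fun p _ => term p)) _.
rewrite -mulr_sumr ler_wpM2l// -mulr_sumr.
have Ngt0 : (0 : R) < #|{: box}|%:R by rewrite ltr0n card_freq_gt0.
rewrite mulrC ler_pdivrMr//.
rewrite -(pair_big predT predT (fun a b : box => if out (freq a - freq b)
      then normc (c (freq a - freq b)) else 0))/=.
have -> : B * #|{: box}|%:R = \sum_(a : box) B by rewrite sumr_const mulr_natr.
apply: ler_sum => a _; rewrite -big_mkcond /=.
have inj : injective (fun b : box => freq a - freq b).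
  by move=> b b' /= /addrI /oppr_inj /freq_inj.
rewrite -big_filter.
rewrite -(big_map (fun b : box => freq a - freq b) predT (fun h => normc (c h))).
apply: cB => [|h /mapP[b]].
  by rewrite map_inj_uniq// filter_uniq// index_enum_uniq.
by rewrite mem_filter => /andP[/asboolP oh _] ->.
Qed.

(** Passing to the limit in the previous bound: the rule and the point
    evaluation only see finitely many values, so pointwise convergence of the
    Fejer means is enough. *)
Lemma lattice_error_cvg g x :
  (forall y, normc (fejer_mean n c y - g y) @[n --> \oo] --> (0 : R)) ->
  normc (g x - lattice_approx z M I g x) <= (1 + L%:R) * B.
Proof.
move=> cvg_g.
apply: (@le_cvg0 _ _ _ (fun n => normc (fejer_mean n c x - g x) +
    node_error (fejer_mean n c) g)) => [|n].
  rewrite -(addr0 (0 : R)). apply: cvgD; first exact: cvg_g.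
  rewrite /node_error.
  have cvg_sum0 (J : Type) (s : seq J) (F : J -> R^nat) :
      (forall i, F i n @[n --> \oo] --> (0 : R)) ->
      (\sum_(i <- s) F i n) @[n --> \oo] --> (0 : R).
    move=> F0; elim: s => [|i s IHs].
      rewrite (_ : (fun n => _) = cst 0); first exact: cvg_cst.
      by apply/funext => n; rewrite big_nil.
    rewrite (_ : (fun n => _) = F i + (fun n => \sum_(j <- s) F j n)).
      by have := cvgD (F0 i) IHs; rewrite addr0; exact.
    by apply/funext => n; rewrite big_cons.
  apply: (cvg_sum0) => l; apply: (cvg_sum0) => h.
  have := cvgM (cvg_cst ((M l)%:R^-1 : R)) (cvg_sum0 _ (index_enum 'I_(M l))
    _ (fun j => cvg_g (lattice_node z M l j))).
  by rewrite mulr0; exact.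
set P := fejer_mean n c.
have -> : g x - lattice_approx z M I g x = (P x - lattice_approx z M I P x) +
    (- (P x - g x) + (lattice_approx z M I P x - lattice_approx z M I g x)).
  by ring.
apply: le_trans (le_normcD _ _) _; rewrite lerD//.
  exact: fejer_mean_lattice_error.
apply: le_trans (le_normcD _ _) _; rewrite normcN lerD2l.
exact: normc_lattice_approxB.
Qed.

End lattice_rule.

(** * Summability of the weights *)

Section weights.
Context {R : realType}.
Local Notation normc := Normc.normc.

(** Cauchy condensation: the block from [2 ^ k] to [2 ^ k.+1] is at most the
    [k]-th term of a geometric series of ratio [2 `^ (1 - s)]. *)
Lemma p_series_bound (s : R) : 1 < s ->
  exists2 Z : R, 0 <= Z & forall m, \sum_(1 <= i < m.+1) i%:R `^ (- s) <= Z.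
Proof.
move=> s1; pose rho : R := 2 `^ (1 - s).
have rho0 : 0 < rho by rewrite powR_gt0.
have rho1 : rho < 1.
  rewrite /rho /powR pnatr_eq0 /= -[ltRHS]expR0 ltr_expR.
  by rewrite pmulr_llt0 ?subr_lt0// ln_gt0// ltr1n.
have geom k : \sum_(j < k) rho ^+ j <= (1 - rho)^-1.
  have := subrX1 rho k; rewrite -opprB -[in RHS](opprB 1) mulNr => /oppr_inj E.
  rewrite -[leRHS]mul1r ler_pdivlMr ?subr_gt0// mulrC -E.
  by rewrite lerBlDr lerDl exprn_ge0// ltW.
have dyadic k : \sum_(1 <= i < (2 ^ k)%N) i%:R `^ (- s) <= \sum_(j < k) rho ^+ j.
  elim: k => [|k IHk]; first by rewrite expn0 big_geq// big_ord0.
  rewrite (@big_cat_nat _ _ _ (2 ^ k)%N)/= ?expn_gt0//; last by rewrite leq_exp2l.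
  rewrite big_ord_recr /= lerD//.
  apply: (@le_trans _ _ (\sum_((2 ^ k)%N <= i < (2 ^ k.+1)%N) (2 ^ k)%:R `^ (- s))).
    apply: ler_sum_nat => i /andP[ki _].
    rewrite !powRN lef_pV2 ?posrE ?powR_gt0 ?ltr0n ?expn_gt0//; last first.
      by rewrite (leq_trans _ ki)// expn_gt0.
    by rewrite ge0_ler_powR ?nnegrE ?ler_nat// (le_trans ler01)// ltW.
  rewrite sumr_const_nat expnS mul2n -addnn addnK.
  have b0 : 0 < (2 ^ k)%:R :> R by rewrite ltr0n expn_gt0.
  have E : (2 ^ k)%:R * (2 ^ k)%:R `^ (- s) = (2 ^ k)%:R `^ (1 - s) :> R.
    by rewrite powRD ?powRr1 ?(ltW b0)// (gt_eqF b0) implybT.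
  rewrite -[leLHS]mulr_natl E natrX -(powR_mulrn _ (ler0n R 2)) powRAC.
  by rewrite powR_mulrn// ltW.
exists (1 - rho)^-1; first by rewrite invr_ge0 subr_ge0 ltW.
move=> m; apply: le_trans (geom m.+1); apply: le_trans (dyadic m.+1).
rewrite (@big_cat_nat _ _ _ m.+1 1 (2 ^ m.+1)%N)//=; last first.
  by apply: ltnW; exact: ltn_expl.
by rewrite lerDl sumr_ge0// => i _; exact: powR_ge0.
Qed.

Section one_weight.
Context {d : nat}.
Variables (alpha : R) (gamma : 'I_d -> R).
Hypothesis alpha_gt0 : 0 < alpha.
Hypothesis gamma_gt0 : forall j, 0 < gamma j.
Local Notation r := (korobov_weight alpha gamma).
Implicit Types (h : 'rV[int]_d).

Definition weight1 j (a : int) : R := Num.max 1 ((gamma j)^-1 * (`|a|%:~R `^ alpha)).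

Lemma weight1_ge1 j a : 1 <= weight1 j a.
Proof. by rewrite /weight1 le_max lexx. Qed.

Lemma korobov_weight_ge1 h : 1 <= r h.
Proof.
rewrite /korobov_weight; elim/big_ind: _ => // [x y x1 y1|j _].
  by rewrite -[leLHS]mulr1 ler_pM.
exact: weight1_ge1.
Qed.

Lemma korobov_weight_gt0 h : 0 < r h.
Proof. exact: lt_le_trans ltr01 (korobov_weight_ge1 h). Qed.

Lemma korobov_weight_powR h q :
  r h `^ q = \prod_j weight1 j (h ord0 j) `^ q.
Proof.
rewrite /korobov_weight -[LHS]/(_ `^ q).
suff [] : 0 <= \prod_j weight1 j (h ord0 j) /\
    (\prod_j weight1 j (h ord0 j)) `^ q = \prod_j weight1 j (h ord0 j) `^ q.
  by [].
elim/big_rec2: _ => [|j x y _ [y0 <-]]; first by rewrite powR1.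
have w0 : 0 <= weight1 j (h ord0 j) by rewrite (le_trans ler01)// weight1_ge1.
by split; [rewrite mulr_ge0|rewrite powRM].
Qed.

(** A finite set of frequencies lies in a box, over which the sum of a product
    is a product of sums.  Integers are coded by a zero or a sign and a positive
    size, so that each factor splits into [1] and two equal sums. *)
Lemma sum_weight_le (q Z : R) : 0 < q ->
  (forall m, \sum_(1 <= i < m.+1) i%:R `^ (- (alpha * q)) <= Z) ->
  forall s : seq 'rV[int]_d, uniq s ->
  \sum_(h <- s) r h `^ (- q) <= \prod_j (1 + 2 * Z * gamma j `^ q).
Proof.
move=> q0 HZ s us.
pose m := \max_(h <- s) \max_j `|h ord0 j|%N.
have hm h j : h \in s -> (`|h ord0 j| <= m)%N.
  move=> hs; apply: leq_trans (leq_bigmax_seq _ hs isT).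
  exact: (leq_bigmax j).
pose J := (unit + bool * 'I_m.+1)%type.
pose dec (u : J) : int := match u with
  | inl _ => 0 | inr (true, i) => Posz i.+1 | inr (false, i) => Negz i end.
pose enc (a : int) : J := match a with
  | Posz 0 => inl tt | Posz n.+1 => inr (true, inord n)
  | Negz n => inr (false, inord n) end.
have encK a : (`|a| <= m)%N -> dec (enc a) = a.
  by case: a => [[|n]|n] //= nm; rewrite inordK// ltnS// ltnW.
pose e h : {ffun 'I_d -> J} := [ffun j => enc (h ord0 j)].
have einj : {in s &, injective e}.
  move=> h k hs ks /ffunP hk; apply/rowP => j; have := hk j; rewrite !ffunE.
  by move=> /(congr1 dec); rewrite !encK ?hm.
pose F j u := weight1 j (dec u) `^ (- q).
have -> : \sum_(h <- s) r h `^ (- q) = \sum_(h <- s) \prod_j F j (e h j).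
  apply: eq_big_seq => h hs; rewrite korobov_weight_powR.
  by apply: eq_bigr => j _; rewrite /F ffunE encK// hm.
rewrite -(big_map e predT (fun f => \prod_j F j (f j))).
have ue : uniq (map e s) by rewrite map_inj_in_uniq.
have F0 j u : 0 <= F j u by exact: powR_ge0.
apply: (@le_trans _ _ (\sum_(f : {ffun 'I_d -> J}) \prod_j F j (f j))).
  rewrite big_uniq// big_mkcond; apply: ler_sum => f _.
  by case: ifP => // _; apply: prodr_ge0.
rewrite -bigA_distr_bigA; apply: ler_prod => j _; rewrite sumr_ge0//=.
rewrite big_sumType /= (big_pred1 tt) => [|[]//]; rewrite lerD//.
  rewrite /F /weight1 /= powR0 ?gt_eqF// mulr0.
  by rewrite (_ : Num.max 1 0 = 1) ?powR1// max_l.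
have Fle b (i : 'I_m.+1) :
    F j (inr (b, i)) <= gamma j `^ q * i.+1%:R `^ (- (alpha * q)).
  have -> : F j (inr (b, i)) =
      (Num.max 1 ((gamma j)^-1 * (i.+1%:R `^ alpha))) `^ (- q).
    by rewrite /F /weight1; case: b => /=; rewrite ?NegzE ?normrN.
  have -> : gamma j `^ q * i.+1%:R `^ (- (alpha * q)) =
      ((gamma j)^-1 * (i.+1%:R `^ alpha)) `^ (- q).
    rewrite powRM ?powR_ge0 ?invr_ge0 ?(ltW (gamma_gt0 _))// -powRrM mulrN.
    by rewrite -powR_inv1 ?(ltW (gamma_gt0 _))// -powRrM mulN1r opprK.
  have p0 : 0 < (gamma j)^-1 * (i.+1%:R `^ alpha).
    by rewrite mulr_gt0 ?invr_gt0 ?powR_gt0.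
  rewrite !powRN lef_pV2 ?posrE ?powR_gt0 ?lt_max ?ltr01//.
  by rewrite ge0_ler_powR ?nnegrE ?le_max ?ler01 ?lexx ?orbT// ltW.
have Zb b : \sum_(i < m.+1) F j (inr (b, i)) <= Z * gamma j `^ q.
  apply: le_trans (ler_sum _ (fun i _ => Fle b i)) _.
  rewrite -mulr_sumr mulrC ler_wpM2r ?powR_ge0//.
  by have := HZ m.+1; rewrite big_add1 /= big_mkord.
have -> : \sum_(p : bool * 'I_m.+1) F j (inr p) =
    \sum_(b : bool) \sum_(i < m.+1) F j (inr (b, i)).
  by rewrite pair_big; apply: eq_bigr => -[].
by rewrite big_bool -mulrA mulr_natl mulr2n lerD.
Qed.

(** Summability uniformly in the dimension: the sum over frequencies factors,
    and the factor [1 + 2 * Z * gamma j `^ q] is at most the exponential of its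
    second term. *)
Lemma sum_weight_le_expR (q Z G : R) : 0 < q -> 0 <= Z ->
  (forall m, \sum_(1 <= i < m.+1) i%:R `^ (- (alpha * q)) <= Z) ->
  \sum_j gamma j `^ q <= G ->
  forall s : seq 'rV[int]_d, uniq s ->
  \sum_(h <- s) r h `^ (- q) <= expR (2 * Z * G).
Proof.
move=> q0 Z0 HZ HG s us; apply: le_trans (sum_weight_le q0 HZ us) _.
apply: (@le_trans _ _ (\prod_j expR (2 * Z * gamma j `^ q))).
  apply: ler_prod => j _; rewrite expR_ge1Dx andbT.
  by rewrite addr_ge0 ?mulr_ge0 ?powR_ge0.
by rewrite -expR_sum ler_expR -mulr_sumr ler_wpM2l// mulr_ge0.
Qed.

(** Rankin's trick: every counted frequency satisfies [1 <= (N / r h) `^ q]. *)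
Lemma card_frequency_le (q N C : R) (s : seq 'rV[int]_d) : 0 <= q ->
  {in s, forall h, r h <= N} -> \sum_(h <- s) r h `^ (- q) <= C ->
  (size s)%:R <= C * N `^ q.
Proof.
move=> q0 sN sC.
have -> : (size s)%:R = \sum_(h <- s) (1 : R).
  by rewrite big_const_seq count_predT iter_addr_0.
have : \sum_(h <- s) 1 <= \sum_(h <- s) r h `^ (- q) * N `^ q.
  rewrite big_seq [leRHS]big_seq; apply: ler_sum => h hs.
  rewrite powRN mulrC ler_pdivlMr ?mul1r ?powR_gt0 ?korobov_weight_gt0//.
  rewrite ge0_ler_powR ?nnegrE ?sN// ?(ltW (korobov_weight_gt0 _))//.
  by rewrite (le_trans (ltW (korobov_weight_gt0 h)))// sN.
by move/le_trans; apply; rewrite -mulr_suml ler_wpM2r ?powR_ge0.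
Qed.

(** Splits [(r h)^-1] into [r h `^ (- q)] and [r h `^ (q - 1)], and uses
    [N <= r h] in the second factor only. *)
Lemma sum_weightV_tail (q N C : R) (s : seq 'rV[int]_d) : q <= 1 -> 0 < N ->
  {in s, forall h, N <= r h} -> \sum_(h <- s) r h `^ (- q) <= C ->
  \sum_(h <- s) (r h)^-1 <= C * N `^ (q - 1).
Proof.
move=> q1 N0 sN sC.
have : \sum_(h <- s) (r h)^-1 <= \sum_(h <- s) r h `^ (- q) * N `^ (q - 1).
  rewrite big_seq [leRHS]big_seq; apply: ler_sum => h hs.
  have r0 := korobov_weight_gt0 h.
  have -> : (r h)^-1 = r h `^ (- q) * r h `^ (q - 1).
    rewrite -powRD ?(gt_eqF r0) ?implybT//.
    by rewrite (_ : - q + (q - 1) = -1) ?powR_inv1// ?ltW//; ring.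
  rewrite ler_wpM2l ?powR_ge0// -opprB !powRN lef_pV2 ?posrE ?powR_gt0//.
  by rewrite ge0_ler_powR ?nnegrE ?subr_ge0// ?sN// ltW.
by move/le_trans; apply; rewrite -mulr_suml ler_wpM2r ?powR_ge0.
Qed.

(** Cauchy-Schwarz against the weights, in the form of the weighted arithmetic
    and geometric means inequality with the optimal parameter [Num.sqrt T]. *)
Lemma sum_normc_le (c : 'rV[int]_d -> R[i]) (T : R) (s : seq 'rV[int]_d) :
  0 < T -> \sum_(h <- s) r h * normc (c h) ^+ 2 <= 1 ->
  \sum_(h <- s) (r h)^-1 <= T -> \sum_(h <- s) normc (c h) <= Num.sqrt T.
Proof.
move=> T0 s1 sT; pose l := Num.sqrt T.
have l0 : 0 < l by rewrite sqrtr_gt0.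
have ll : T = l * l by rewrite -expr2 sqr_sqrtr// ltW.
have H : \sum_(h <- s) normc (c h) <=
    \sum_(h <- s) (l / 2 * (r h * normc (c h) ^+ 2) + (2 * l)^-1 * (r h)^-1).
  apply: ler_sum => h _; have r0 := korobov_weight_gt0 h.
  have a0 : 0 < 2 * l * r h by rewrite !mulr_gt0.
  (* Multiplied by [2 * l * r h], the claim says that the square of
     [l * r h * normc (c h) - 1] is nonnegative. *)
  rewrite -(ler_pM2l a0) mulrDr.
  have -> : 2 * l * r h * ((2 * l)^-1 * (r h)^-1) = 1.
    by field; rewrite !gt_eqF.
  have -> : 2 * l * r h * (l / 2 * (r h * normc (c h) ^+ 2)) =
      (l * r h * normc (c h)) ^+ 2 by field.
  by have := sqr_ge0 (l * r h * normc (c h) - 1); rewrite sqrrB1; lra.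
apply: le_trans H _; rewrite big_split /= -!mulr_sumr.
have : l / 2 * \sum_(h <- s) r h * normc (c h) ^+ 2 <= l / 2.
  by rewrite -[leRHS]mulr1 ler_wpM2l// divr_ge0// ltW.
have : (2 * l)^-1 * \sum_(h <- s) (r h)^-1 <= l / 2.
  have -> : l / 2 = (2 * l)^-1 * T by rewrite ll; field; rewrite gt_eqF.
  by rewrite ler_wpM2l// invr_ge0 mulr_ge0// ltW.
by rewrite -/l => h1 h2; rewrite [leRHS]splitr lerD.
Qed.

Lemma korobov_norm_le1 (f : 'rV[R]_d -> R[i]) (s : seq 'rV[int]_d) :
  (korobov_norm alpha gamma f <= 1)%E -> uniq s ->
  \sum_(h <- s) r h * normc (fourier_coef f h) ^+ 2 <= 1.
Proof.
rewrite /korobov_norm; set E := esum _ _ => E1 us.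
have E0 : (0 <= E)%E.
  apply: esum_ge0 => h _; rewrite lee_fin mulr_ge0 ?sqr_ge0//.
  exact: ltW (korobov_weight_gt0 h).
have EE : (E <= 1)%E.
  have E2 : E = ((E `^ 2^-1) `^ 2)%E by rewrite -poweRrM mulVf// poweRe1.
  rewrite [leLHS]E2 -[leRHS](poweR1r 2).
  by apply: gt0_ler_poweR => //; rewrite in_itv /= leey andbT ?poweR_ge0// lee01.
rewrite -lee_fin; apply: le_trans EE; apply: esum_ge.
exists [set` s]; first by split=> //; exact: finite_seq.
by rewrite -fsbig_seq//= sumEFin.
Qed.

End one_weight.
End weights.

(** * The rate of convergence *)

Section rate.
Context {R : realType}.

(** Unfolds the extended-real hypothesis on [t].  The infimum [w] defining
    [weight_decay] satisfies [w < 1 / (2 t + 1)], so some admissible [s] does, and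
    [q] is the midpoint between the larger of [s] and [1 / alpha] and the bound
    [1 / (2 t + 1)]; admissibility passes from [s] to [q] since [gamma <= 1]. *)
Lemma exponent_exists (alpha : R) (gamma : forall d, 'I_d -> R) (t : R) :
  1 < alpha -> (forall d i, 0 < gamma d i <= 1) -> 0 < t ->
  (weight_decay gamma < 1)%E ->
  (t%:E < (alpha_tilde alpha gamma - 1) / 2%:E)%E ->
  exists q G : R, [/\ 0 < q, 2 * t + 1 < q^-1, 1 < alpha * q &
    forall d, (1 <= d)%N -> \sum_(j < d) gamma d j `^ q <= G].
Proof.
move=> a1 g01 t0 wd1 tlt; have a0 : 0 < alpha by rewrite (lt_trans ltr01).
have T0 : 0 < 2 * t + 1 by rewrite addr_gt0// mulr_gt0.
have wd0 : (0 <= weight_decay gamma)%E.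
  by apply: le_ereal_inf_tmp => _ [s [s0 _] <-]; rewrite lee_fin.
have wdfin : weight_decay gamma \is a fin_num.
  by rewrite ge0_fin_numE// (lt_trans wd1)// ltry.
move: wd1 tlt wd0; rewrite /alpha_tilde -(fineK wdfin).
set w := fine _ => wd1 tlt wd0.
have [ta wt] : 2 * t + 1 < alpha /\ w < (2 * t + 1)^-1.
  have two0 : (2 : R) != 0 by [].
  have [w0|wn0] := eqVneq w 0.
    move: tlt; rewrite w0 inver eqxx.
    rewrite (_ : Order.min alpha%:E +oo = alpha%:E)%E; last first.
      by apply/min_idPl; rewrite leey.
    rewrite inver (negbTE two0) -EFinB -EFinM lte_fin => tl.
    by rewrite invr_gt0; split=> //; lra.
  have wp : 0 < w by rewrite lt_def wn0 -lee_fin.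
  move: tlt; rewrite !inver (negbTE wn0) (negbTE two0) -EFin_min -EFinB -EFinM.
  rewrite lte_fin => tl.
  have : 2 * t + 1 < Num.min alpha w^-1 by lra.
  rewrite lt_min => /andP[-> h]; split=> //.
  by rewrite -[w]invrK ltf_pV2 ?posrE ?invr_gt0.
have : (weight_decay gamma < ((2 * t + 1)^-1)%:E)%E.
  by rewrite -(fineK wdfin) lte_fin.
move/ereal_inf_lt => [_ [s [s0 supfin] <-]]; rewrite lte_fin => st.
pose m := Num.max s alpha^-1.
have mlt : m < (2 * t + 1)^-1 by rewrite gt_max st ltf_pV2 ?posrE.
pose q := (m + (2 * t + 1)^-1) / 2.
have mq : m < q by rewrite midf_lt.
have qlt : q < (2 * t + 1)^-1 by rewrite midf_lt.
have m0 : 0 < m by rewrite lt_max invr_gt0 a0 orbT.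
have q0 : 0 < q by rewrite (lt_trans m0).
have sq : s <= q by apply: le_trans (ltW mq); rewrite le_max lexx.
pose E := ereal_sup [set (\sum_(j < d) gamma d j `^ s)%:E | d in [set d | (1 <= d)%N]].
have EP d : (1 <= d)%N -> ((\sum_(j < d) gamma d j `^ s)%:E <= E)%E.
  by move=> d1; apply: ereal_sup_ubound; exists d.
have Efin : E \is a fin_num.
  rewrite fin_numElt supfin andbT; apply: lt_le_trans (EP 1%N isT).
  exact: ltNyr.
exists q, (fine E); split=> //.
- by rewrite -[ltLHS]invrK ltf_pV2 ?posrE ?invr_gt0.
- rewrite mulrC -ltr_pdivrMr// mul1r; apply: le_lt_trans mq.
  by rewrite le_max lexx orbT.
- move=> d d1; rewrite -lee_fin fineK//; apply: le_trans (EP d d1).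
  rewrite lee_fin; apply: ler_sum => j _; exact: ger_powR.
Qed.

Lemma ln_le_powR (x e : R) : 1 <= x -> 0 < e -> Num.max (ln x) 1 <= (1 + e^-1) * x `^ e.
Proof.
move=> x1 e0; have x0 : 0 < x by rewrite (lt_le_trans ltr01).
have p0 : 0 < x `^ e by rewrite powR_gt0.
have p1 : 1 <= x `^ e by rewrite -(powRr0 x) ler_powR// ltW.
have i0 : 0 < e^-1 by rewrite invr_gt0.
rewrite ge_max; apply/andP; split; last by nra.
have : e * ln x < x `^ e by rewrite -ln_powR ln_sublinear.
rewrite mulrC -ltr_pdivlMr// => /ltW /le_trans; apply.
by rewrite mulrDl mul1r mulrC lerDr ltW.
Qed.

(** The logarithms coming from [L] and from the size of the lattice are absorbed
    by the gap between [t] and the exponent [(q^-1 - 1) / 2]. *)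
Lemma rate_bound (q t C : R) : 0 < q -> 0 < t -> 2 * t + 1 < q^-1 -> 0 < C ->
  exists c : R, forall (n : nat) (N L m : R), (0 < n)%N -> 1 <= N ->
    n%:R <= C * N `^ q -> L <= Num.max (3 * ln n%:R) 1 -> 0 < m ->
    m < 9 * n%:R * Num.max (ln n%:R) 1 ->
    (1 + L) * Num.sqrt (C * N `^ (q - 1)) < c * m `^ (- t).
Proof.
move=> q0 t0 tq C0; pose tau := (q^-1 - 1) / 2.
have ttau : t < tau by rewrite /tau; lra.
(* The logarithm [l] occurs to the power [1 + t]: once from [1 + L] and [t] times
   from the size of the lattice; hence this exponent in [ln_le_powR]. *)
pose delta := (tau - t) / (1 + t).
have t1 : 0 < 1 + t by rewrite addr_gt0.
have delta0 : 0 < delta by rewrite divr_gt0 ?subr_gt0.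
pose D := Num.sqrt C * C `^ tau; pose K := 1 + delta^-1.
have K0 : 0 < K by rewrite addr_gt0// invr_gt0.
have D0 : 0 < D by rewrite mulr_gt0 ?sqrtr_gt0 ?powR_gt0.
pose c0 := 4 * D * K `^ (1 + t) * 9 `^ t.
exists (c0 + 1) => n N L m n0 N1 nCN Ll m0 mlt.
have N0 : 0 < N by rewrite (lt_le_trans ltr01).
have nR1 : 1 <= n%:R :> R by rewrite ler1n.
have nR0 : 0 < n%:R :> R by rewrite ltr0n.
set l := Num.max (ln n%:R) 1 in mlt.
have l1 : 1 <= l by rewrite le_max lexx orbT.
have l0 : 0 < l by rewrite (lt_le_trans ltr01).
have L4 : 1 + L <= 4 * l.
  have : ln n%:R <= l by rewrite le_max lexx.
  have : L <= 3 * l.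
    apply: le_trans Ll _; rewrite ge_max; apply/andP; split; last by lra.
    by rewrite ler_pM2l// le_max lexx.
  by lra.
have sqrtle : Num.sqrt (C * N `^ (q - 1)) <= D * n%:R `^ (- tau).
  rewrite sqrtrM ?(ltW C0)// /D -mulrA ler_wpM2l ?sqrtr_ge0//.
  rewrite -powR12_sqrt ?powR_ge0// -powRrM.
  have -> : (q - 1) / 2 = q * - tau by rewrite /tau; field; rewrite gt_eqF.
  rewrite powRrM.
  have -> : C `^ tau * n%:R `^ (- tau) = (n%:R / C) `^ (- tau).
    rewrite powRM ?(ltW nR0) ?invr_ge0 ?(ltW C0)// mulrC; congr (_ * _).
    by rewrite -powR_inv1 ?(ltW C0)// -powRrM mulN1r opprK.
  rewrite !powRN lef_pV2 ?posrE ?powR_gt0 ?divr_gt0//.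
  rewrite ge0_ler_powR ?nnegrE ?powR_ge0 ?divr_ge0 ?(ltW nR0) ?(ltW C0)//.
    by rewrite /tau; lra.
  by rewrite ler_pdivrMr// mulrC.
have lK : l `^ (1 + t) <= K `^ (1 + t) * n%:R `^ (tau - t).
  have -> : n%:R `^ (tau - t) = (n%:R `^ delta) `^ (1 + t) :> R.
    by rewrite -powRrM /delta divfK// gt_eqF.
  rewrite -powRM ?powR_ge0 ?(ltW K0)//.
  rewrite ge0_ler_powR ?nnegrE ?mulr_ge0 ?powR_ge0 ?(ltW K0) ?(ltW l0) ?(ltW t1)//.
  exact: ln_le_powR.
have mle : (9 * n%:R * l) `^ (- t) <= m `^ (- t).
  rewrite !powRN lef_pV2 ?posrE ?powR_gt0 ?mulr_gt0//.
  by rewrite ge0_ler_powR ?nnegrE ?mulr_ge0 ?(ltW t0) ?(ltW m0) ?(ltW nR0)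
    ?(ltW l0) ?(ltW mlt).
have c00 : 0 < c0.
  by apply: mulr_gt0; [apply: mulr_gt0; [exact: mulr_gt0|]|]; rewrite powR_gt0.
apply: (@le_lt_trans _ _ (c0 * m `^ (- t))); last first.
  by rewrite ltr_pM2r ?powR_gt0// ltrDl.
apply: (@le_trans _ _ (c0 * (9 * n%:R * l) `^ (- t))); last first.
  by rewrite ler_pM2l.
apply: (@le_trans _ _ (4 * l * (D * n%:R `^ (- tau)))).
  apply: le_trans (ler_wpM2r _ L4) _; first exact: sqrtr_ge0.
  by rewrite ler_wpM2l// mulr_ge0// ltW.
have -> : c0 * (9 * n%:R * l) `^ (- t) =
    4 * D * K `^ (1 + t) * n%:R `^ (- t) * l `^ (- t).
  rewrite 2?powRM ?mulr_ge0 ?(ltW nR0) ?(ltW l0)// /c0.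
  have e9 : 9 `^ t * 9 `^ (- t) = 1 :> R by rewrite powRN mulfV// gt_eqF// powR_gt0.
  transitivity (4 * D * K `^ (1 + t) * (9 `^ t * 9 `^ (- t)) *
    n%:R `^ (- t) * l `^ (- t)).
    by ring.
  by rewrite e9 mulr1.
have -> : 4 * l * (D * n%:R `^ (- tau)) =
    4 * D * l `^ (1 + t) * n%:R `^ (- tau) * l `^ (- t).
  have -> : l `^ (1 + t) = l * l `^ t.
    by rewrite powRD ?powRr1 ?(ltW l0)// (gt_eqF l0) implybT.
  have el : l `^ t * l `^ (- t) = 1 by rewrite powRN mulfV// gt_eqF// powR_gt0.
  transitivity (4 * l * (D * n%:R `^ (- tau)) * (l `^ t * l `^ (- t))).
    by rewrite el mulr1.
  by ring.
rewrite ler_wpM2r ?powR_ge0//.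
have -> : n%:R `^ (- t) = n%:R `^ (tau - t) * n%:R `^ (- tau) :> R.
  rewrite -powRD ?(gt_eqF nR0) ?implybT//.
  by rewrite (_ : tau - t - tau = - t)//; ring.
rewrite [leRHS]mulrA ler_wpM2r ?powR_ge0// -[leRHS]mulrA.
by apply: ler_wpM2l lK; rewrite mulr_ge0// ltW.
Qed.

End rate.

Theorem corollary4p7 (R : realType) (alpha : R)
    (gamma : forall d : nat, 'I_d -> R)
    (alpha_gt1 : 1 < alpha)
    (gamma_le1 : forall (d : nat) (i : 'I_d), gamma d i <= 1)
    (gamma_gt0 : forall (d : nat) (i : 'I_d), 0 < gamma d i)
    (gamma_decr : forall (d : nat) (i j : 'I_d),
      (i <= j)%N -> gamma d j <= gamma d i)
    (decay_lt1 : (weight_decay gamma < 1)%E)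
    (t : R) (t_gt0 : 0 < t)
    (t_lt : (t%:E < (alpha_tilde alpha gamma - 1) / 2%:E)%E) :
  exists c : R, forall (d : nat) (N : R) (L : nat)
      (z : 'I_L -> 'rV[int]_d) (M : 'I_L -> nat),
    let I := frequency_set alpha (gamma d) N in
    let cardI := card_of I in
    let cardLambda := card_of (@multiple_lattice R d L z M) in
    (1 <= d)%N -> 1 <= N ->
    (1 <= L)%N -> (forall l, (1 <= M l)%N) ->
    I = \bigcup_(l in [set: 'I_L]) alias_free_part z M I l ->
    L%:R <= Num.max (3 * ln cardI%:R) 1 :> R ->
    (forall l l', M l = M l') ->
    (forall l, (M l <= 3 * cardI)%N) ->
    (2 * cardI < cardLambda)%N ->
    cardLambda%:R < 9 * cardI%:R * Num.max (ln cardI%:R) 1 :> R ->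
    (worst_case_error alpha (gamma d) I z M
       < (c * cardLambda%:R `^ (- t))%:E)%E.
Proof.
have g01 d i : 0 < gamma d i <= 1 by rewrite gamma_gt0 gamma_le1.
have [q [G [q0 tq aq sumG]]] := exponent_exists alpha_gt1 g01 t_gt0 decay_lt1 t_lt.
have [Z Z0 HZ] := p_series_bound aq.
have alpha0 : 0 < alpha by exact: lt_trans ltr01 alpha_gt1.
pose C := expR (2 * Z * G).
have C0 : 0 < C by exact: expR_gt0.
have [c Hc] := rate_bound q0 t_gt0 tq C0.
exists c => d N L z M I cardI cardLambda d1 N1 L1 M1 coverI Lle _ _ card2 cardlt.
have N0 : 0 < N by exact: lt_le_trans ltr01 N1.
(* An infinite or empty [I] would have [cardI = 0], against the upper bound on
   the size of the lattice. *)
have cardI0 : (0 < cardI)%N.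
  rewrite lt0n; apply/eqP => I0; move: cardlt; rewrite I0 mulr0 mul0r.
  by rewrite ltrn0.
have finI : finite_set I.
  apply: contrapT => infI; move: cardI0.
  by rewrite /cardI /card_of /fset_set; case: pselect => //; rewrite cardfs0.
have sumC := sum_weight_le_expR alpha0 (gamma_gt0 d) q0 Z0 HZ (sumG d d1).
have cardC : cardI%:R <= C * N `^ q.
  apply: (@card_frequency_le _ _ alpha (gamma d) q N C (fset_set I)).
  - exact: ltW.
  - by move=> h; rewrite in_fset_set// inE.
  - exact/sumC/fset_uniq.
have m0 : 0 < cardLambda%:R :> R.
  by rewrite ltr0n (leq_ltn_trans _ card2).
pose B := Num.sqrt (C * N `^ (q - 1)).
have q1 : q <= 1.
  rewrite -[leLHS]invrK invf_le1 ?invr_gt0// (le_trans _ (ltW tq))// lerDr.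
  by rewrite mulr_ge0// ltW.
apply: le_lt_trans (_ : ((1 + L%:R) * B)%:E < _)%E; last first.
  by rewrite lte_fin; exact: Hc cardC Lle m0 cardlt.
apply: ge_ereal_sup => _ [f [g [[_ [intRe intIm] _] norm1 fg ->]]].
have T0 : 0 < C * N `^ (q - 1) by rewrite mulr_gt0 ?powR_gt0.
have cB (s : seq 'rV[int]_d) : uniq s -> (forall h, h \in s -> ~ I h) ->
    \sum_(h <- s) Normc.normc (fourier_coef f h) <= B.
  move=> us sI; apply: (sum_normc_le (alpha := alpha) (gamma := gamma d)) => //.
    exact: korobov_norm_le1.
  apply: sum_weightV_tail => //; last exact: sumC.
  by move=> h /sI /negP; rewrite -ltNge => /ltW.
have err := fun x => lattice_error_cvg M1 finI coverI cB x
  (fun y => fejer_mean_cvg y (conj intRe intIm) fg).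
rewrite /Linfty_norm unlock; case: ifP => _; last first.
  by rewrite lee_fin mulr_ge0 ?sqrtr_ge0// addr_ge0.
apply/ess_supP; apply: nearW => x /=; rewrite lee_fin ger0_norm; last first.
  by case: (_ - _) => ? ?; exact: sqrtr_ge0.
exact: err.
Qed.
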